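(* Consider the event-triggered distributed estimator described in the context, and suppose: (i) the communication graph is connected, i.e. $\lambda_2(\mathcal{L})>0$; (ii) $G=\sum_{i=1}^N H_i^TH_i$ is full rank; (iii) there is $\epsilon_1>0$ with $\mathbb{E}\{\|V(t)\|^{2+\epsilon_1}\}<\infty$; (iv) the step sizes are $\alpha(t)=\frac{a}{(t+1)^{\tau_1}}$ and $\beta(t)=\frac{b}{(t+1)^{\tau_2}}$ with $a,b>0$, $0<\tau_2\le\tau_1\le 1$, and $\tau_1>\max\{\tau_2+\frac{1}{2+\epsilon_1},0.5\}$. Let $\rho_0=\min_{j\in\mathcal{V}}\rho_j$. If $\rho_0>\tau_1-\tau_2$, then for every $i\in\mathcal{V}$, $\mathbb{P}\big(\lim_{t\to\infty}x_i(t)=\theta\big)=1$.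
   Context: An unknown parameter $\theta\in\mathbb{R}^n$ is observed by $N$ agents $\mathcal{V}=\{1,\dots,N\}$ via $y_i(t)=H_i\theta+v_i(t)$, $t=0,1,2,\dots$, where $H_i\in\mathbb{R}^{m_i\times n}$ is known and the noise $v_i(t)\in\mathbb{R}^{m_i}$ is zero mean with covariance $R_i$. The stacked noise $V(t)=[v_1(t)^T,\dots,v_N(t)^T]^T$ is i.i.d. over time (noises of different agents at the same time may be correlated). Agents communicate over an undirected graph without self-loops with adjacency matrix $\mathcal{A}=[a_{ij}]\in\{0,1\}^{N\times N}$, neighbor sets $\mathcal{N}_i=\{j: a_{ij}=1\}$, degree matrix $\mathcal{D}$ and Laplacian $\mathcal{L}=\mathcal{D}-\mathcal{A}$. Each agent $i$ has a threshold exponent $\rho_i>0$. Agent $i$ keeps an estimate $x_i(t)\in\mathbb{R}^n$ (arbitrary deterministic initial value $x_i(0)$, which is the first transmitted value). Let $t_k^i$ be the latest triggering (transmission) time of agent $i$. At time $t$, agent $i$ triggers (broadcasts $x_i(t)$ to its neighbors, which then becomes its latest transmitted value) iff $\|x_i(t)-x_i(t_k^i)\|>\frac{1}{(t+1)^{\rho_i}}$. Denoting by $x_j(t_k^j)$ the latest value transmitted by agent $j$ up to and including time $t$, the estimator is $x_i(t+1)=x_i(t)+\alpha(t)H_i^T\big(y_i(t)-H_ix_i(t)\big)+\beta(t)\sum_{j\in\mathcal{N}_i}\big(x_j(t_k^j)-x_i(t)\big)$. *)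

(* Defs.v *)
From HB Require Import structures.
From mathcomp Require Import all_boot all_order all_algebra.
From mathcomp Require Import all_classical all_reals all_analysis.
Set Implicit Arguments. Unset Strict Implicit. Unset Printing Implicit Defensive.
Import Order.TTheory GRing.Theory Num.Theory.
Import numFieldNormedType.Exports.
Local Open Scope classical_set_scope.
Local Open Scope ring_scope.

Section Defs.
Variable R : realType.

Definition enorm (p : nat) (u : 'cV[R]_p) : R := Num.sqrt (\sum_(k < p) u k ord0 ^+ 2).

Variables (N n : nat) (m : 'I_N -> nat).

Definition stacked_norm (V : forall i : 'I_N, 'cV[R]_(m i)) : R :=
  Num.sqrt (\sum_(i < N) \sum_(k < m i) V i k ord0 ^+ 2).

Definition threshold (rho : R) (t : nat) : R := ((t.+1)%:R `^ rho)^-1.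

Definition step (c tau : R) (t : nat) : R := c / ((t.+1)%:R `^ tau).

Variables (H : forall i : 'I_N, 'M[R]_(m i, n)) (theta : 'cV[R]_n)
  (A : rel 'I_N) (rho : 'I_N -> R) (alpha beta : nat -> R)
  (x0 : 'I_N -> 'cV[R]_n)
  (* one realization of the noise: vw t i = v_i(t) *)
  (vw : nat -> forall i : 'I_N, 'cV[R]_(m i)).

Definition meas (t : nat) (i : 'I_N) : 'cV[R]_(m i) := H i *m theta + vw t i.

(* latest transmitted value of agent j up to and including time t, given
   the current estimate x j = x_j(t) and the latest transmitted value zp j
   up to time t-1 (agent j triggers iff ||x_j(t) - zp_j|| > 1/(t+1)^rho_j) *)
Definition transmitted (t : nat) (x zp : 'I_N -> 'cV[R]_n) (j : 'I_N) : 'cV[R]_n :=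
  if threshold (rho j) t < enorm (x j - zp j) then x j else zp j.

(* est_state t = (x(t), latest transmitted values up to time t-1);
   at t = 0 the first transmitted value is x(0). *)
Fixpoint est_state (t : nat) : ('I_N -> 'cV[R]_n) * ('I_N -> 'cV[R]_n) :=
  match t with
  | 0 => (x0, x0)
  | t'.+1 =>
    let: (x, zp) := est_state t' in
    let z := transmitted t' x zp in
    (fun i => x i + alpha t' *: ((H i)^T *m (meas t' i - H i *m x i))
                  + beta t' *: \sum_(j < N | A i j) (z j - x i), z)
  end.

Definition estimate (t : nat) (i : 'I_N) : 'cV[R]_n := (est_state t).1 i.

End Defs.

Section Noise.
Local Open Scope ereal_scope.
Context {R : realType} {d : measure_display} {T : measurableType d}.
Variables (P : probability T R) (N : nat) (m : 'I_N -> nat)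
  (v : nat -> T -> forall i : 'I_N, 'cV[R]_(m i)).

Definition noise_rect (t : nat) (B : forall i : 'I_N, 'I_(m i) -> set R) : set T :=
  [set w | forall (i : 'I_N) (k : 'I_(m i)), B i k (v t w i k ord0)].

Definition borel_rect (B : forall i : 'I_N, 'I_(m i) -> set R) :=
  forall (i : 'I_N) (k : 'I_(m i)), measurable (B i k).

(* V(0), V(1), ... mutually independent: product rule on every finite
   family of times, for the generating pi-system of measurable rectangles *)
Definition noise_indep : Prop :=
  forall (S : seq nat) (B : nat -> forall i : 'I_N, 'I_(m i) -> set R),
    uniq S -> (forall t, borel_rect (B t)) ->
    P (\big[setI/setT]_(t <- S) noise_rect t (B t)) =
    \prod_(t <- S) P (noise_rect t (B t)).

(* V(t) identically distributed (joint laws agree on rectangles,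
   which determines the joint law) *)
Definition noise_ident : Prop :=
  forall (t : nat) (B : forall i : 'I_N, 'I_(m i) -> set R),
    borel_rect B -> P (noise_rect t B) = P (noise_rect 0 B).

Definition noise_iid : Prop := noise_indep /\ noise_ident.

End Noise.

(* Main.v *)
(* Write e for the vector of the errors x_i - theta, L for the Laplacian, D for
   diag(H_i^T H_i), W for the vector of the H_i^T v_i, and delta_j for the gap
   between the last value sent by j and x_j, which is at most (t+1)^(-rho_j). Then
     e(t+1) = e - beta L e - alpha D e + alpha W + beta (Adj delta),
   Adj being the adjacency matrix.
   The noise W splits into its average Wbar and the disagreement W - 1 Wbar.
   The disagreement is absorbed by p(t+1) = p - beta L p + alpha (W - 1 Wbar),
   p(0) = 0: the moment condition and tau1 - tau2 > 1/(2+eps1) give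
   (alpha/beta) |W| -> 0 almost surely, and on vectors of zero sum I - beta L
   contracts at rate beta, so p -> 0. The average is absorbed by the tail
   r(t) = sum over s >= t of alpha Wbar(s), which exists almost surely because
   2 tau1 > 1; for this the Rademacher-Menshov inequality suffices, which uses only
   that the noise is uncorrelated in time. Since L kills 1 r, the remainder
   u = e - p + 1 r satisfies
     u(t+1) = u - beta L u - alpha D u + alpha xi,
   where xi -> 0 because rho_j > tau1 - tau2. As L + D is coercive (connectedness
   and full rank of G) and alpha <= beta eventually, |u|^2 contracts at rate alpha,
   whose sum diverges as tau1 <= 1; hence u -> 0. *)
Require Import Defs.
From HB Require Import structures.
From mathcomp Require Import all_boot all_order all_algebra.
From mathcomp Require Import all_classical all_reals all_analysis.
From mathcomp Require Import measurable_realfun ring lra.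
Import Order.TTheory GRing.Theory Num.Theory.
Import numFieldNormedType.Exports.
Local Open Scope classical_set_scope.
Local Open Scope ring_scope.
Set Implicit Arguments.
Unset Strict Implicit.

(** * Almost sure bounds and products of independent variables *)

Section Probability.
Context d (T : measurableType d) (R : realType) (P : probability T R).

(** The sum of all [f n] has integral at most [M], so it is finite almost surely; being a sum of
    nonnegative terms, it dominates each of them. *)
Lemma ae_bounded_of_summable_expectation (f : nat -> T -> R) (c : nat -> R) (M : R) :
  (forall n, measurable_fun setT (f n)) -> (forall n w, 0 <= f n w) ->
  (forall n, (\int[P]_w (f n w)%:E <= (c n)%:E)%E) ->
  (forall n, \sum_(0 <= k < n) c k <= M) ->
  {ae P, forall w, exists B, forall n, f n w <= B}.
Proof.
move=> mf f0 fc cM.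
pose g (w : T) : \bar R := (\sum_(0 <= n <oo) (f n w)%:E)%E.
have mg : measurable_fun setT g.
  apply: ge0_emeasurable_sum => [n w _ _|n _]; first by rewrite lee_fin.
  exact/measurable_EFinP.
have g0 w : (0 <= g w)%E by apply: nneseries_ge0 => n _ _; rewrite lee_fin.
have ig : P.-integrable setT g.
  apply/integrableP; split => //.
  under eq_integral do rewrite gee0_abs//.
  rewrite integral_nneseries//=; last 2 first.
    by move=> n; exact/measurable_EFinP.
    by move=> n x _; rewrite lee_fin.
  apply: (@le_lt_trans _ _ M%:E); last exact: ltry.
  apply: lime_le.
    by apply: is_cvg_nneseries => n _ _; apply: integral_ge0 => x _; rewrite lee_fin.
  near=> n; apply: (@le_trans _ _ (\sum_(0 <= k < n) (c k)%:E)%E).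
    by apply: lee_sum => k _; exact: fc.
  by rewrite sumEFin lee_fin.
have := integrable_ae measurableT ig; apply: filterS => w /(_ I) gw.
exists (fine (g w)) => n; rewrite -lee_fin fineK//.
rewrite /g (@nneseriesD1 _ _ n xpredT)//; last by move=> k _; rewrite lee_fin.
by rewrite leeDl// nneseries_ge0// => k _ _; rewrite lee_fin.
Unshelve. all: by end_near. Qed.

(** The rule on rectangles identifies the joint law with the product of the marginals; Fubini then
    integrates [X] first, which gives 0 for each fixed value of [Y]. *)
Lemma integral_mul_indep (X Y : {mfun T >-> R}) :
  (forall A B : set R, measurable A -> measurable B ->
    P ((X @^-1` A) `&` (Y @^-1` B)) = (P (X @^-1` A) * P (Y @^-1` B))%E) ->
  P.-integrable setT (EFin \o X) ->
  P.-integrable setT (EFin \o (X \* Y)) ->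
  (\int[P]_w (X w)%:E = 0)%E ->
  (\int[P]_w (X w * Y w)%:E = 0)%E.
Proof.
move=> indep iX iXY X0.
have mXY : measurable_fun setT (fun w => (X w, Y w)) by exact: measurable_fun_pair.
pose XY : {mfun T >-> (R * R)%type} := HB.pack (fun w => (X w, Y w))
  (isMeasurableFun.Build _ _ _ _ _ mXY).
pose m1 := distribution P X; pose m2 := distribution P Y.
pose h (z : R * R) : \bar R := (z.1 * z.2)%:E.
have mh : measurable_fun setT h.
  by apply/measurable_EFinP; exact: measurable_funM.
have prodE A : measurable A -> (m1 \x m2)%E A = distribution P XY A.
  by move=> mA; apply: product_measure_unique.
have hXY : (h \o XY) = (EFin \o (X \* Y)) by [].
have ih : (distribution P XY).-integrable setT h.
  by apply: integrable_pushforward => //; rewrite preimage_setT hXY.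
have eqm g : (\int[(m1 \x m2)%E]_z g z = \int[distribution P XY]_z g z)%E.
  by apply: eq_measure_integral => A mA _; exact: prodE.
have ih' : (m1 \x m2)%E.-integrable setT h.
  by apply/integrableP; split => //; rewrite eqm; case/integrableP : ih.
have iid : m1.-integrable setT (EFin \o idfun).
  by apply: integrable_pushforward => //; apply/measurable_EFinP; exact: measurable_id.
transitivity (\int[distribution P XY]_z h z)%E.
  by rewrite integral_pushforward// preimage_setT hXY.
rewrite -eqm -integral21_prod_meas1//=.
apply: integral0_eq => y _; rewrite /fubini_G /h /=.
under eq_integral do rewrite EFinM.
rewrite integralZr//.
rewrite (_ : (\int[m1]_x x%:E)%E = 0%E) ?mul0e//.
have -> : (\int[m1]_x x%:E = \int[m1]_x (EFin \o idfun) x)%E by [].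
rewrite integral_pushforward//; last by apply/measurable_EFinP; exact: measurable_id.
Qed.

End Probability.

(** * The Rademacher-Menshov maximal inequality *)

Section DyadicBlocks.
Context {R : realType}.
Implicit Types (y : nat -> R) (l : R).

(* Dominates, by [sum_sqr_le_menshov], the squares of all partial sums over the
   block of length [2 ^ m] starting at [s], using only sums over dyadic blocks.
   The free parameter [l] keeps the loss per scale down to a factor [1 + l]. *)
Fixpoint menshov y l (m s : nat) : R :=
  if m is m'.+1 then
    menshov y l m' s + (1 + l^-1) * (\sum_(s <= t < s + 2 ^ m') y t) ^+ 2
      + (1 + l) * menshov y l m' (s + 2 ^ m')
  else y s ^+ 2.

Lemma menshov_ge0 y l m s : 0 < l -> 0 <= menshov y l m s.
Proof.
move=> l0; elim: m s => [s|m IH s] /=; first exact: sqr_ge0.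
by rewrite !addr_ge0// mulr_ge0 ?sqr_ge0 ?addr_ge0 ?invr_ge0// ltW.
Qed.

(** Young's inequality: the two sides differ by the square of [u - l * v] divided by [l]. *)
Lemma sqrrD_le (l u v : R) : 0 < l ->
  (u + v) ^+ 2 <= (1 + l^-1) * u ^+ 2 + (1 + l) * v ^+ 2.
Proof.
move=> l0; rewrite -subr_ge0.
have -> : (1 + l^-1) * u ^+ 2 + (1 + l) * v ^+ 2 - (u + v) ^+ 2 =
  l^-1 * (u - l * v) ^+ 2 by field; rewrite gt_eqF.
by rewrite mulr_ge0 ?sqr_ge0// invr_ge0 ltW.
Qed.

(** Induction on the scale. A sum that stops in the first half is covered by that half; a longer one
    is split at the midpoint into a full half block and a partial sum of the second half. *)
Lemma sum_sqr_le_menshov y l m s k : 0 < l -> (k <= 2 ^ m)%N ->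
  (\sum_(s <= t < s + k) y t) ^+ 2 <= menshov y l m s.
Proof.
move=> l0; elim: m s k => [s|m IH s] k.
  rewrite expn0 /=; case: k => [|[|//]] _; first by rewrite addn0 big_geq// expr0n sqr_ge0.
  by rewrite addn1 big_nat1.
have Qge0 := menshov_ge0 y m _ l0.
move=> km /=; have [k2|k2] := leqP k (2 ^ m).
  apply: (le_trans (IH s k k2)); rewrite -addrA lerDl addr_ge0// mulr_ge0 ?sqr_ge0//.
    by rewrite addr_ge0// invr_ge0 ltW.
  by rewrite addr_ge0// ltW.
rewrite (@big_cat_nat _ _ _ (s + 2 ^ m))/= ?leq_addr ?leq_add2l//; last exact: ltnW.
apply: (le_trans (sqrrD_le _ _ l0)); rewrite -addrA ler_wpDl// lerD2l.
rewrite ler_pM2l ?addr_gt0//.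
have -> : (s + k = s + 2 ^ m + (k - 2 ^ m))%N by rewrite -addnA subnKC// ltnW.
by apply: IH; rewrite leq_subLR addnn -mul2n -expnS.
Qed.

(** The blocks from [2 ^ m - 1] to [2 ^ m.+1 - 1] tile the naturals, so the geometric bounds on
    partial block sums add up to a Cauchy estimate. *)
Lemma cvg_series_of_dyadic y (B q : R) : 0 <= q < 1 ->
  (forall m k, (k <= 2 ^ m)%N ->
    `|\sum_((2 ^ m).-1 <= t < (2 ^ m).-1 + k) y t| <= B * q ^+ m) ->
  cvgn (series y).
Proof.
move=> /andP[q0 q1] yB.
have B0 : 0 <= B by have := yB 0 0 isT; rewrite addn0 big_geq// normr0 expr0 mulr1.
have s_ge m : (m <= (2 ^ m).-1)%N by rewrite -ltnS prednK ?expn_gt0// ltn_expl.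
have sS m : ((2 ^ m.+1).-1 = (2 ^ m).-1 + 2 ^ m)%N.
  by rewrite expnS mul2n -addnn; case: (2 ^ m)%N (expn_gt0 2 m) => // k _; rewrite addSn addnS.
(* Here [n] is fuel for crossing blocks: passing from [m] to [m.+1] uses one unit and keeps [m + n]
   fixed. *)
have tail n m t : ((2 ^ m).-1 <= t)%N -> (t <= m + n)%N ->
    `|\sum_((2 ^ m).-1 <= k < t) y k| <= B * q ^+ m / (1 - q).
  have direct m' : ((2 ^ m').-1 <= t)%N -> (t <= (2 ^ m'.+1).-1)%N ->
      `|\sum_((2 ^ m').-1 <= k < t) y k| <= B * q ^+ m' / (1 - q).
    move=> mt; rewrite sS => tm.
    have := yB m' (t - (2 ^ m').-1)%N; rewrite subnKC// leq_subLR => /(_ tm)/le_trans; apply.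
    rewrite ler_peMr ?mulr_ge0 ?exprn_ge0// invf_ge1 ?subr_gt0//.
    by rewrite gerBl.
  elim: n m => [|n IH] m mt tn.
    apply: direct => //; apply: (leq_trans tn); rewrite addn0.
    exact: leq_trans (s_ge m.+1).
  have [tm|tm] := leqP t (2 ^ m.+1).-1; first exact: direct.
  rewrite (@big_cat_nat _ _ _ (2 ^ m.+1).-1)/= ?(ltnW tm)//; last by rewrite sS leq_addr.
  apply: (le_trans (ler_normD _ _)).
  have := IH m.+1 (ltnW tm); rewrite addSnnS => /(_ tn) h.
  have := yB m _ (leqnn _); rewrite -sS => h'.
  apply: (le_trans (lerD h' h)); rewrite exprS.
  have -> : B * q ^+ m + B * (q * q ^+ m) / (1 - q) = B * q ^+ m / (1 - q).
    by field; rewrite subr_eq0 gt_eqF.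
  by [].
apply/cauchy_cvgP/cauchy_seriesP => e e0.
(* The factor 2 appears because a sum over an interval is a difference of two sums starting at
   [(2 ^ m).-1]. *)
have : (fun m => B * q ^+ m / (1 - q) *+ 2) @ \oo --> (0 : R).
  rewrite (_ : 0 = B * 0 / (1 - q) *+ 2); last by rewrite mulr0 mul0r mul0rn.
  apply: cvgMn; apply: cvgMl; apply: cvgMr.
  by apply: cvg_expr; rewrite ger0_norm.
move/cvgrPdist_lt => /(_ e e0)[m _ /(_ m (leqnn m))]; rewrite sub0r normrN => me.
exists ([set t | (2 ^ m).-1 <= t]%N, [set t | (2 ^ m).-1 <= t]%N) => /=.
  by split; exists (2 ^ m).-1.
move=> [n1 n2] /= [mn1 mn2].
have bound t : ((2 ^ m).-1 <= t)%N ->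
    `|\sum_((2 ^ m).-1 <= k < t) y k| <= B * q ^+ m / (1 - q).
  by move=> mt; apply: (tail t) => //; rewrite leq_addl.
have [n12|/ltnW n12] := leqP n1 n2; last by rewrite big_geq// normr0.
have -> : \sum_(n1 <= k < n2) y k =
    \sum_((2 ^ m).-1 <= k < n2) y k - \sum_((2 ^ m).-1 <= k < n1) y k.
  by rewrite [X in _ = X - _](@big_cat_nat _ _ _ n1)//= addrAC subrr add0r.
apply: le_lt_trans me; apply: (le_trans (ler_normB _ _)).
rewrite [leRHS]ger0_norm; last by rewrite mulrn_wge0// !mulr_ge0 ?exprn_ge0// invr_ge0 subr_ge0 ltW.
by rewrite mulr2n lerD// bound.
Qed.

Lemma geometric_sum_le (c x : R) n : 0 <= c -> 0 <= x < 1 ->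
  \sum_(0 <= k < n) c * x ^+ k <= c / (1 - x).
Proof.
move=> c0 /andP[x0 x1].
have -> : \sum_(0 <= k < n) c * x ^+ k = c * (1 - x ^+ n) / (1 - x).
  elim: n => [|n IH]; first by rewrite big_geq// expr0 subrr mulr0 mul0r.
  by rewrite big_nat_recr//= IH exprS; field; rewrite subr_eq0 gt_eqF.
rewrite ler_pM2r ?invr_gt0 ?subr_gt0// ler_piMr// gerBl exprn_ge0//.
Qed.

End DyadicBlocks.

(** * Almost sure convergence of orthogonal series *)

Section Orthogonal.
Context d (T : measurableType d) (R : realType) (P : probability T R).
Variables (Y : nat -> T -> R) (V : nat -> R).
Hypothesis mY : forall t, measurable_fun setT (Y t).
Hypothesis iYY : forall s t, P.-integrable setT (fun w => (Y s w * Y t w)%:E).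
Hypothesis oY : forall s t, s != t -> (\int[P]_w (Y s w * Y t w)%:E = 0)%E.
Hypothesis vY : forall t, (\int[P]_w (Y t w ^+ 2)%:E <= (V t)%:E)%E.

Lemma expectation_sqr_sum_le m n :
  (\int[P]_w ((\sum_(m <= t < n) Y t w) ^+ 2)%:E <= (\sum_(m <= t < n) V t)%:E)%E.
Proof.
under eq_integral => w _.
  rewrite expr2 big_distrlr/= -sumEFin.
  under eq_bigr do rewrite -sumEFin.
  over.
rewrite integral_sum//; last first.
  by move=> i; apply: integrable_sum => // j _; exact: iYY.
rewrite -sumEFin big_seq [leRHS]big_seq; apply: lee_sum => i; rewrite mem_index_iota => imn.
rewrite integral_sum//.
rewrite (bigD1_seq i) ?mem_index_iota ?iota_uniq//= big1 ?adde0; last first.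
  by move=> j ji; rewrite oY// eq_sym.
by have := vY i; under eq_integral do rewrite expr2.
Qed.

Lemma measurable_menshov l m s : measurable_fun setT (fun w => menshov (Y^~ w) l m s).
Proof.
elim: m s => [s|m IH s] /=; first exact: measurable_funX.
apply: measurable_funD; last by apply: measurable_funM => //; exact: measurable_cst.
apply: measurable_funD => //; apply: measurable_funM; first exact: measurable_cst.
by apply: measurable_funX; apply: measurable_sum.
Qed.

(* With K' = (1 + l) / l^2, the sequence c_m = (K' + 1) (1 + l)^m - K' solves
   c_0 = 1, c_(m+1) = (1 + l) c_m + (1 + 1/l). *)
Lemma expectation_menshov_le (l : R) m s : 0 < l ->
  (\int[P]_w (menshov (Y^~ w) l m s)%:E <=
   ((((1 + l) / l ^+ 2 + 1) * (1 + l) ^+ m - (1 + l) / l ^+ 2)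
     * \sum_(s <= t < s + 2 ^ m) V t)%:E)%E.
Proof.
move=> l0; have V0 t : 0 <= V t.
  rewrite -lee_fin; apply: le_trans (vY t); apply: integral_ge0 => w _.
  by rewrite lee_fin sqr_ge0.
have c1 : 0 <= 1 + l^-1 by rewrite addr_ge0// invr_ge0 ltW.
have c2 : 0 <= 1 + l by rewrite addr_ge0// ltW.
set K' := (1 + l) / l ^+ 2.
have K'0 : 0 <= K' by rewrite divr_ge0// sqr_ge0.
have coef0 m' : 1 <= (K' + 1) * (1 + l) ^+ m' - K'.
  rewrite lerBrDl ler_peMr ?addr_ge0// exprn_ege1// lerDl; exact: ltW.
elim: m s => [s|m IH s] /=.
  by rewrite expn0 addn1 big_nat1 expr0 mulr1 addrAC subrr add0r mul1r.
have Q0 s' w : 0 <= menshov (Y^~ w) l m s' by exact: menshov_ge0.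
under eq_integral do rewrite !EFinD.
have mQ := measurable_menshov l m.
rewrite ge0_integralD//=; first last.
- by apply/measurable_EFinP; apply: measurable_funM => //; exact: measurable_cst.
- by move=> w _; rewrite lee_fin mulr_ge0.
- apply: emeasurable_funD; first exact/measurable_EFinP.
  apply/measurable_EFinP; apply: measurable_funM; first exact: measurable_cst.
  by apply: measurable_funX; apply: measurable_sum.
- by move=> w _; rewrite -EFinD lee_fin addr_ge0// mulr_ge0// sqr_ge0.
rewrite ge0_integralD//=; first last.
- apply/measurable_EFinP; apply: measurable_funM; first exact: measurable_cst.
  by apply: measurable_funX; apply: measurable_sum.
- by move=> w _; rewrite lee_fin mulr_ge0// sqr_ge0.
- exact/measurable_EFinP.
- by move=> w _; rewrite lee_fin.
under [X in (_ + X + _ <= _)%E]eq_integral do rewrite EFinM.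
under [X in (_ + X <= _)%E]eq_integral do rewrite EFinM.
rewrite !ge0_integralZl_EFin//=; first last.
- by apply/measurable_EFinP; apply: measurable_funX; apply: measurable_sum.
- by move=> w _; rewrite lee_fin sqr_ge0.
- exact/measurable_EFinP.
- by move=> w _; rewrite lee_fin.
set V1 := \sum_(s <= t < s + 2 ^ m) V t.
set V2 := \sum_(s + 2 ^ m <= t < s + 2 ^ m + 2 ^ m) V t.
have -> : \sum_(s <= t < s + 2 ^ m.+1) V t = V1 + V2.
  by rewrite expnS mul2n -addnn addnA (@big_cat_nat _ _ _ (s + 2 ^ m))/= ?leq_addr.
have V10 : 0 <= V1 by exact: sumr_ge0.
have V20 : 0 <= V2 by exact: sumr_ge0.
apply: (@le_trans _ _ ((((K' + 1) * (1 + l) ^+ m - K') * V1)%:E + (1 + l^-1)%:E * V1%:E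
   + (1 + l)%:E * (((K' + 1) * (1 + l) ^+ m - K') * V2)%:E))%E.
  apply: leeD; first apply: leeD; first exact: IH.
    by apply: lee_wpmul2l; [rewrite lee_fin|exact: expectation_sqr_sum_le].
  by apply: lee_wpmul2l; [rewrite lee_fin|exact: IH].
rewrite -!EFinM -!EFinD lee_fin exprS.
set C := (1 + l) ^+ m.
rewrite -subr_ge0.
have -> : ((K' + 1) * ((1 + l) * C) - K') * (V1 + V2) -
   (((K' + 1) * C - K') * V1 + (1 + l^-1) * V1 + (1 + l) * (((K' + 1) * C - K') * V2))
  = l * ((K' + 1) * C - K') * V1 + (1 + l^-1) * V2.
  by rewrite /K'; field; rewrite gt_eqF.
by rewrite addr_ge0// mulr_ge0// mulr_ge0 ?(ltW l0)// (le_trans _ (coef0 m)).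
Qed.

(** The maximal inequality loses a factor of order [(1 + l) ^+ m] on block [m], which the decay
    [q ^+ m] of the variances outweighs for small [l]. For [r] between [(1 + l) * q] and 1, the
    block maxima weighted by [r ^- m] have summable expectations, so almost surely the partial sums
    in block [m] are bounded by a multiple of [Num.sqrt r ^+ m]. *)
Lemma ae_cvg_series_orthogonal (M q : R) : 0 < q < 1 ->
  (forall m, \sum_((2 ^ m).-1 <= t < (2 ^ m).-1 + 2 ^ m) V t <= M * q ^+ m) ->
  {ae P, forall w, cvgn (series (Y^~ w))}.
Proof.
move=> /andP[q0 q1] VM.
(* This choice makes [(1 + l) * q] equal to [2 * q / (1 + q)], which is below 1. *)
pose l := (1 - q) / (1 + q).
have l0 : 0 < l by rewrite divr_gt0// ?subr_gt0 ?addr_gt0.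
pose q1' := (1 + l) * q.
have q1'E : q1' = q * 2 / (1 + q) by rewrite /q1' /l; field; rewrite gt_eqF// addr_gt0.
have q1'0 : 0 < q1' by rewrite mulr_gt0// addr_gt0.
have q1'1 : q1' < 1.
  rewrite q1'E ltr_pdivrMr ?addr_gt0// mul1r; lra.
pose r := (1 + q1') / 2.
have rq : q1' < r by rewrite /r; lra.
have r1 : r < 1 by rewrite /r; lra.
have r0 : 0 < r by exact: lt_trans rq.
pose K := (1 + l) / l ^+ 2 + 1.
have K0 : 0 <= K by rewrite addr_ge0// divr_ge0 ?sqr_ge0// addr_ge0// ltW.
have M0 : 0 <= M.
  have V0 : 0 <= V 0 by rewrite -lee_fin; apply: le_trans (vY 0);
    apply: integral_ge0 => w _; rewrite lee_fin sqr_ge0.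
  by have := VM 0; rewrite expn0 /= big_nat1 expr0 mulr1; exact: le_trans.
have : {ae P, forall w, exists B, forall m,
    r ^- m * menshov (Y^~ w) l m (2 ^ m).-1 <= B}.
  apply: (@ae_bounded_of_summable_expectation _ _ _ P _
    (fun m => K * M * (q1' / r) ^+ m) (K * M / (1 - q1' / r))).
  - move=> m; apply: measurable_funM; [exact: measurable_cst|exact: measurable_menshov].
  - by move=> m w; rewrite mulr_ge0 ?menshov_ge0// invr_ge0 exprn_ge0// ltW.
  - move=> m.
    under eq_integral do rewrite EFinM.
    rewrite ge0_integralZl_EFin//=; first last.
    + by rewrite invr_ge0 exprn_ge0// ltW.
    + apply/measurable_EFinP; exact: measurable_menshov.
    + by move=> w _; rewrite lee_fin menshov_ge0.
    have rm : 0 <= r ^- m by rewrite invr_ge0 exprn_ge0// ltW.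
    apply: (@le_trans _ _ ((r ^- m)%:E * (K * (1 + l) ^+ m * (M * q ^+ m))%:E)%E).
      apply: lee_wpmul2l; first by rewrite lee_fin.
      apply: (le_trans (expectation_menshov_le _ _ l0)); rewrite lee_fin.
      have -> : (1 + l) / l ^+ 2 = K - 1 by rewrite /K addrK.
      have S0 : 0 <= \sum_((2 ^ m).-1 <= t < (2 ^ m).-1 + 2 ^ m) V t.
        apply: sumr_ge0 => t _; rewrite -lee_fin; apply: le_trans (vY t).
        by apply: integral_ge0 => w _; rewrite lee_fin sqr_ge0.
      apply: (@le_trans _ _ (K * (1 + l) ^+ m *
          \sum_((2 ^ m).-1 <= t < (2 ^ m).-1 + 2 ^ m) V t)).
        by rewrite ler_wpM2r// subrK gerBl subr_ge0 lerDr divr_ge0 ?sqr_ge0// addr_ge0// ltW.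
      by rewrite ler_wpM2l// mulr_ge0// exprn_ge0// addr_ge0// ltW.
    rewrite -EFinM lee_fin.
    have -> : (q1' / r) ^+ m = (1 + l) ^+ m * q ^+ m / r ^+ m.
      by rewrite exprMn exprVn /q1' exprMn.
    have := exprn_gt0 m r0; move: (r ^+ m) ((1 + l) ^+ m) (q ^+ m) => x y z x0. 
    by rewrite le_eqVlt; apply/orP; left; apply/eqP; field; rewrite gt_eqF.
  - move=> n; apply: geometric_sum_le; first exact: mulr_ge0.
    by rewrite divr_ge0 ?(ltW q1'0) ?(ltW r0)//= ltr_pdivrMr// mul1r.
apply: filterS => w [B QB].
apply: (@cvg_series_of_dyadic _ _ (Num.sqrt B) (Num.sqrt r)).
  by rewrite sqrtr_ge0/= -sqrtr1 ltr_sqrt.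
move=> m k km.
have rm : 0 < r ^+ m by rewrite exprn_gt0.
have QBm : menshov (Y^~ w) l m (2 ^ m).-1 <= B * r ^+ m.
  by rewrite -ler_pdivrMr// mulrC.
have B0 : 0 <= B.
  by have := le_trans (menshov_ge0 (Y^~ w) m (2 ^ m).-1 l0) QBm; rewrite pmulr_lge0.
rewrite -(@ler_pXn2r _ 2)//; last by rewrite nnegrE mulr_ge0 ?exprn_ge0 ?sqrtr_ge0.
rewrite real_normK ?num_real// exprMn -exprM mulnC exprM !sqr_sqrtr ?(ltW r0)//.
exact: le_trans (sum_sqr_le_menshov _ _ l0 km) QBm.
Qed.
End Orthogonal.

(** * Weighted sums of the noise *)

Section PowerSequences.
Context {R : realType}.

Lemma cvg_natS_powRN (s : R) : 0 < s -> (fun t : nat => t.+1%:R `^ (- s)) @ \oo --> (0 : R).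
Proof.
move=> s0; apply/cvgrPdist_lt => e e0.
have [N _ Nh] : \forall t \near \oo, (e^-1) `^ s^-1 < t%:R :> R by exact: nbhs_infty_gtr.
exists N => // t /= /Nh et.
rewrite sub0r normrN ger0_norm ?powR_ge0// powRN invf_plt ?posrE ?powR_gt0//.
have -> : e^-1 = ((e^-1) `^ s^-1) `^ s.
  by rewrite -powRrM mulVf ?gt_eqF// powRr1// invr_ge0 ltW.
apply: gt0_ltr_powR => //; rewrite ?nnegrE ?powR_ge0//.
by apply: (lt_trans et); rewrite ltr_nat.
Qed.

Lemma lt1r_powR (a s : R) : 1 < a -> 1 < s -> a < a `^ s.
Proof.
move=> a1 s1; have a0 : 0 < a by exact: lt_trans a1.
have -> : s = 1 + (s - 1) by ring.
rewrite (_ : a `^ _ = a `^ 1 * a `^ (s - 1)); last first.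
  by rewrite -powRD// (gt_eqF a0) implybT.
rewrite powRr1 ?(ltW a0)// ltr_pMr//.
have {1}-> : 1 = 1 `^ (s - 1) :> R by rewrite powR1.
apply: gt0_ltr_powR; rewrite ?nnegrE ?(ltW a0)//.
by rewrite subr_gt0.
Qed.

Lemma powR_exprn (a s : R) m : 0 <= a -> (a ^+ m) `^ s = (a `^ s) ^+ m.
Proof. by move=> a0; rewrite -(powR_mulrn m a0) -(powR_mulrn m (powR_ge0 a s)) powRAC. Qed.

Lemma sum_powRN_dyadic_le (s : R) m : 0 <= s ->
  \sum_((2 ^ m).-1 <= t < (2 ^ m).-1 + 2 ^ m) t.+1%:R `^ (- s) <= (2 / 2 `^ s) ^+ m.
Proof.
move=> s0; apply: (@le_trans _ _ (\sum_((2 ^ m).-1 <= t < (2 ^ m).-1 + 2 ^ m) (2 `^ s) ^- m)).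
  rewrite big_seq [leRHS]big_seq; apply: ler_sum => t; rewrite mem_index_iota => /andP[mt _].
  rewrite powRN -powR_exprn ?ler0n// -natrX lef_pV2 ?posrE ?powR_gt0 ?ltr0n ?expn_gt0//.
  apply: ge0_ler_powR; rewrite ?nnegrE//.
  by rewrite ler_nat -(@prednK (2 ^ m)%N) ?expn_gt0// ltnS.
by rewrite big_const_nat addKn iter_addr_0 -[leLHS]mulr_natl natrX expr_div_n.
Qed.

Lemma sum_powRN_le (s : R) n : 1 < s ->
  \sum_(0 <= t < n) t.+1%:R `^ (- s) <= 1 / (1 - 2 / 2 `^ s).
Proof.
move=> s1.
have q01 : 0 <= 2 / 2 `^ s < 1.
  rewrite divr_ge0 ?powR_ge0//= ltr_pdivrMr ?powR_gt0// mul1r.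
  by rewrite lt1r_powR// ltr1n.
have dy m : \sum_(0 <= t < (2 ^ m).-1) t.+1%:R `^ (- s) <=
    \sum_(0 <= j < m) 1 * (2 / 2 `^ s) ^+ j.
  elim: m => [|m IH]; first by rewrite !big_geq.
  have -> : ((2 ^ m.+1).-1 = (2 ^ m).-1 + 2 ^ m)%N.
    by rewrite expnS mul2n -addnn; case: (2 ^ m)%N (expn_gt0 2 m) => // k _; rewrite addSn addnS.
  rewrite (@big_cat_nat _ _ _ (2 ^ m).-1)//= ?leq_addr// big_nat_recr//= lerD// mul1r.
  by apply: sum_powRN_dyadic_le; rewrite ltW// (lt_trans _ s1).
apply: le_trans (geometric_sum_le n ler01 q01); apply: le_trans (dy n).
have nn : (n <= (2 ^ n).-1)%N by rewrite -ltnS prednK ?expn_gt0// ltn_expl.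
rewrite [leRHS](@big_cat_nat _ _ _ n)//= lerDl sumr_ge0// => t _; exact: powR_ge0.
Qed.

End PowerSequences.

(** * Weighted scalar i.i.d. noise with a moment of order above 2 *)

Section IidNoise.
Context d (T : measurableType d) (R : realType) (P : probability T R).
Variables (X : nat -> {mfun T >-> R}) (p : R).
Hypothesis identX : forall t (B : set R), measurable B ->
  P (X t @^-1` B) = P (X 0 @^-1` B).
Hypothesis indepX : forall s t (A B : set R), s != t -> measurable A -> measurable B ->
  P ((X s @^-1` A) `&` (X t @^-1` B)) = (P (X s @^-1` A) * P (X t @^-1` B))%E.
Hypothesis X_mean0 : forall t, (\int[P]_w (X t w)%:E = 0)%E.
Hypothesis p2 : 2 < p.
Hypothesis X_moment : (\int[P]_w (`|X 0 w| `^ p)%:E < +oo)%E.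

Lemma expectation_ident (g : R -> R) t : measurable_fun setT g -> (forall x, 0 <= g x) ->
  (\int[P]_w (g (X t w))%:E = \int[P]_w (g (X 0 w))%:E)%E.
Proof.
move=> mg g0.
have mg' : measurable_fun setT (EFin \o g) by exact/measurable_EFinP.
have g0' x : (0 <= (EFin \o g) x)%E by rewrite lee_fin.
have E s := @ge0_integral_distribution _ _ _ _ _ P (X s) _ mg' g0'.
rewrite -[LHS]E -[RHS]E; apply: eq_measure_integral => B mB _.
exact: identX.
Qed.

Lemma integrable_powR_noise t : P.-integrable setT (fun w => (`|X t w| `^ p)%:E).
Proof.
have mpow : measurable_fun setT (fun x : R => `|x| `^ p).
  by apply: (measurableT_comp (measurable_powR p)); exact: normr_measurable.
apply/integrableP; split.
  by apply/measurable_EFinP; exact: (measurableT_comp mpow).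
under eq_integral do rewrite gee0_abs ?lee_fin ?powR_ge0//.
by rewrite (expectation_ident _ mpow) // => x; exact: powR_ge0.
Qed.

(** As [p] exceeds 2, the square is dominated by 1 plus the [p]-th absolute power. *)
Lemma integrable_sqr_noise t : P.-integrable setT (fun w => (X t w ^+ 2)%:E).
Proof.
apply: (@le_integrable _ _ _ P setT measurableT _
  (fun w => ((EFin \o cst 1%R) w + (`|X t w| `^ p)%:E)%E)).
- by apply/measurable_EFinP; exact: measurable_funX.
- move=> w _; rewrite /= lee_fin.
  rewrite ger0_norm ?sqr_ge0// ger0_norm ?addr_ge0 ?powR_ge0//.
  rewrite -real_normK ?num_real// -powR_mulrn//.
  have [x1|x1] := leP 1 `|X t w|.
    by rewrite ler_wpDl// ler_powR// ltW.
  rewrite ler_wpDr ?powR_ge0// powR_mulrn//; apply: exprn_ile1 => //; exact: ltW.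
apply: integrableD => //; first exact: finite_measure_integrable_cst.
exact: integrable_powR_noise.
Qed.

Lemma integrable_mul_noise s t : P.-integrable setT (fun w => (X s w * X t w)%:E).
Proof.
apply: (@le_integrable _ _ _ P setT measurableT _
  (fun w => ((X s w ^+ 2)%:E + (X t w ^+ 2)%:E)%E)).
- by apply/measurable_EFinP; exact: measurable_funM.
- move=> w _; rewrite -EFinD /= lee_fin [leRHS]ger0_norm ?addr_ge0 ?sqr_ge0//.
  by rewrite ler_norml; apply/andP; split; nra.
by apply: integrableD => //; exact: integrable_sqr_noise.
Qed.

Lemma integrable_noise t : P.-integrable setT (EFin \o X t).
Proof.
apply: (@le_integrable _ _ _ P setT measurableT _
  (fun w => ((EFin \o cst 1%R) w + (X t w ^+ 2)%:E)%E)).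
- exact/measurable_EFinP.
- move=> w _; rewrite /= lee_fin [leRHS]ger0_norm ?addr_ge0 ?sqr_ge0//.
  by rewrite ler_norml; apply/andP; split; nra.
apply: integrableD => //; first exact: finite_measure_integrable_cst.
exact: integrable_sqr_noise.
Qed.

Lemma noise_orthogonal s t : s != t -> (\int[P]_w (X s w * X t w)%:E = 0)%E.
Proof.
move=> st; apply: integral_mul_indep => //.
- by move=> A B mA mB; exact: indepX.
- exact: integrable_noise.
- exact: integrable_mul_noise.
Qed.

Lemma ae_cvg_series_step (a tau : R) : 1 / 2 < tau ->
  {ae P, forall w, cvgn (series (fun t => step a tau t * X t w))}.
Proof.
move=> tau2.
pose sigma2 := fine (\int[P]_w (X 0 w ^+ 2)%:E)%E.
have sigma2E t : (\int[P]_w (X t w ^+ 2)%:E = sigma2%:E)%E.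
  rewrite (expectation_ident t (g := fun x => x ^+ 2)) ?fineK//.
  - apply: integrable_fin_num => //; exact: integrable_sqr_noise.
  - by move=> x; exact: sqr_ge0.
have sigma20 : 0 <= sigma2.
  by rewrite -lee_fin -(sigma2E 0); apply: integral_ge0 => w _; rewrite lee_fin sqr_ge0.
have stepE t : step a tau t ^+ 2 = a ^+ 2 * t.+1%:R `^ (- (2 * tau)).
  by rewrite /step expr_div_n powRN mulrC [(2 * tau)%R]mulrC powRrM powR_mulrn ?powR_ge0// mulrC.
apply: (@ae_cvg_series_orthogonal _ _ _ P (fun t w => step a tau t * X t w)
  (fun t => step a tau t ^+ 2 * sigma2) _ _ _ _ (a ^+ 2 * sigma2) (2 / 2 `^ (2 * tau))).
- by move=> t; apply: measurable_funM => //; exact: measurable_cst.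
- move=> s t.
  rewrite (_ : (fun w => _) = fun w => ((step a tau s * step a tau t)%:E * (X s w * X t w)%:E)%E).
    by apply: integrableZl => //; exact: integrable_mul_noise.
  by apply/funext => w; rewrite -EFinM mulrACA.
- move=> s t st.
  under eq_integral do rewrite mulrACA EFinM.
  by rewrite integralZl// ?noise_orthogonal ?mule0//; exact: integrable_mul_noise.
- move=> t; under eq_integral do rewrite exprMn EFinM.
  by rewrite integralZl// ?sigma2E//; exact: integrable_sqr_noise.
- rewrite divr_gt0 ?powR_gt0//= ltr_pdivrMr ?powR_gt0// mul1r.
  by rewrite lt1r_powR ?ltr1n//; lra.
- move=> m; under eq_bigr do rewrite stepE mulrAC.
  rewrite -mulr_sumr ler_wpM2l ?(mulr_ge0 (sqr_ge0 a) sigma20)//.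
  apply: sum_powRN_dyadic_le; lra.
Qed.

(** For [k] between [1 / p] and [s], the expectations of [|X t| ^ p / (t+1) ^ (k p)] are summable,
    since [k * p] exceeds 1. Hence almost surely [X t] grows at most like [(t+1) ^ k], and the
    surplus [s - k] forces convergence to 0. *)
Lemma ae_cvg_powRN_noise (s : R) : 1 / p < s ->
  {ae P, forall w, (fun t : nat => t.+1%:R `^ (- s) * X t w) @ \oo --> (0 : R)}.
Proof.
move=> ps; have p0 : 0 < p by rewrite (lt_trans _ p2).
pose k := (1 / p + s) / 2.
have pk : 1 < k * p.
  by rewrite -ltr_pdivrMr// /k; lra.
have ks : k < s by rewrite /k; lra.
pose mu := fine (\int[P]_w (`|X 0 w| `^ p)%:E)%E.
have mpow : measurable_fun setT (fun x : R => `|x| `^ p).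
  by apply: (measurableT_comp (measurable_powR p)); exact: normr_measurable.
have muE t : (\int[P]_w (`|X t w| `^ p)%:E = mu%:E)%E.
  rewrite (expectation_ident t mpow) ?fineK//.
  by apply: integrable_fin_num => //; exact: integrable_powR_noise.
have mu0 : 0 <= mu.
  by rewrite -lee_fin -(muE 0); apply: integral_ge0 => w _; rewrite lee_fin powR_ge0.
have : {ae P, forall w, exists B, forall t, t.+1%:R `^ (- (k * p)) * `|X t w| `^ p <= B}.
  apply: (@ae_bounded_of_summable_expectation _ _ _ P _
    (fun t => mu * t.+1%:R `^ (- (k * p))) (mu * (1 / (1 - 2 / 2 `^ (k * p))))).
  - move=> t; apply: measurable_funM; first exact: measurable_cst.
    exact: (measurableT_comp mpow).
  - by move=> t w; rewrite mulr_ge0 ?powR_ge0.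
  - move=> t; under eq_integral do rewrite EFinM.
    rewrite integralZl//; last exact: integrable_powR_noise.
    by rewrite muE -EFinM lee_fin mulrC.
  - by move=> n; rewrite -mulr_sumr ler_wpM2l// sum_powRN_le.
apply: filterS => w [B hB].
have XB t : `|t.+1%:R `^ (- s) * X t w| <= B `^ p^-1 * t.+1%:R `^ (- (s - k)).
  have t0 : 0 < t.+1%:R :> R by rewrite ltr0n.
  rewrite normrM (ger0_norm (powR_ge0 _ _)).
  have -> : - s = - (s - k) + - k by ring.
  rewrite powRD; last by rewrite (gt_eqF t0) implybT.
  rewrite -mulrA mulrC ler_wpM2r ?powR_ge0//.
  have -> : t.+1%:R `^ (- k) * `|X t w| = (t.+1%:R `^ (- (k * p)) * `|X t w| `^ p) `^ p^-1.
    rewrite powRM ?powR_ge0// -!powRrM mulNr mulfK ?gt_eqF// mulfV ?gt_eqF//.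
    by rewrite powRr1.
  by apply: ge0_ler_powR; rewrite ?nnegrE ?invr_ge0 ?(ltW p0) ?mulr_ge0 ?powR_ge0//
    (le_trans _ (hB t)) ?mulr_ge0 ?powR_ge0.
apply/norm_cvg0P.
apply: (@squeeze_cvgr _ _ _ _ (cst 0) (fun t : nat => B `^ p^-1 * t.+1%:R `^ (- (s - k)))).
- by near=> t; rewrite normr_ge0 XB.
- exact: cvg_cst.
- rewrite -(mulr0 (B `^ p^-1)); apply: cvgMr; apply: cvg_natS_powRN; lra.
Unshelve. all: by end_near. Qed.

End IidNoise.

(** * Deterministic contraction *)

Section ScalarRecursion.
Context {R : realType}.

(** Once [e] is below [eps / 2], the excess of [y] over [eps / 2] shrinks by [1 - g t], hence by at
    most [expR (- g t)]; these factors multiply to the exponential of minus a divergent sum. *)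
Lemma cvg0_of_contraction (y g e : nat -> R) :
  (forall t, 0 <= y t) ->
  (\forall t \near \oo, 0 <= g t <= 1) ->
  (\forall t \near \oo, y t.+1 <= (1 - g t) * y t + g t * e t) ->
  series g @ \oo --> +oo ->
  e @ \oo --> (0 : R) ->
  y @ \oo --> (0 : R).
Proof.
move=> y0 g01 rec gy e0; apply/cvgrPdist_lt => eps eps0.
have eps20 : 0 < eps / 2 by rewrite divr_gt0.
have he : \forall t \near \oo, e t <= eps / 2.
  move/cvgrPdist_le : e0 => /(_ _ eps20); apply: filterS => t.
  by rewrite sub0r normrN; exact: le_trans (ler_norm _).
have [M _ HM] : \forall t \near \oo, [/\ 0 <= g t <= 1,
    y t.+1 <= (1 - g t) * y t + g t * e t & e t <= eps / 2].
  by near=> t; split; near: t.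
pose z t := Num.max (y t - eps / 2) 0.
have z0 t : 0 <= z t by rewrite le_max lexx orbT.
have zS t : (M <= t)%N -> z t.+1 <= expR (- g t) * z t.
  move=> Mt; have [/andP[g0 g1] yS et] := HM t Mt.
  apply: (@le_trans _ _ ((1 - g t) * z t)); last first.
    by rewrite ler_wpM2r// (le_trans _ (expR_ge1Dx _)).
  rewrite ge_max mulr_ge0 ?subr_ge0// andbT.
  have h1 : y t - eps / 2 <= z t by rewrite le_max lexx.
  have h2 : (1 - g t) * (y t - eps / 2) <= (1 - g t) * z t by rewrite ler_wpM2l// subr_ge0.
  have h3 : g t * e t <= g t * (eps / 2) by rewrite ler_wpM2l.
  lra.
have zM n : z (M + n)%N <= expR (series g M - series g (M + n)%N) * z M.
  elim: n => [|n IH]; first by rewrite addn0 subrr expR0 mul1r.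
  rewrite addnS; apply: (le_trans (zS _ (leq_addr _ _))).
  have -> : series g M - series g (M + n).+1 =
      - g (M + n)%N + (series g M - series g (M + n)%N).
    by rewrite /series/= big_nat_recr//=; ring.
  by rewrite expRD -mulrA ler_wpM2l// expR_ge0.
(* With [1 + x <= expR x], this growth of the series is enough to bring the excess below
   [eps / 2]. *)
have [M' _ HM'] : \forall t \near \oo, series g M + 2 * z M / eps < series g t.
  by move/cvgryPgt : gy; exact.
exists (maxn M M') => // t /=; rewrite geq_max => /andP[Mt M't].
rewrite sub0r normrN ger0_norm//.
have := HM' t M't => gt.
have := zM (t - M)%N; rewrite subnKC// => zt.
have : z t < eps / 2.
  apply: (le_lt_trans zt); rewrite -opprB expRN mulrC ltr_pdivrMr ?expR_gt0//.
  rewrite mulrC -ltr_pdivrMr//.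
  apply: lt_le_trans (expR_ge1Dx _).
  have -> : z M / (eps / 2) = 2 * z M / eps by field; rewrite gt_eqF.
  lra.
by rewrite gt_max => /andP[]; lra.
Unshelve. all: by end_near. Qed.

Lemma series_step_dvg (c tau : R) : 0 < c -> 0 <= tau <= 1 ->
  series (step c tau) @ \oo --> +oo.
Proof.
move=> c0 tau01.
have -> : series (step c tau) = (fun n => c * series (riemannR tau) n).
  by apply/funext => n; rewrite /series/= mulr_sumr.
have [tau0 tau1] := andP tau01.
apply/cvgryPge => B.
have : series (riemannR tau) @ \oo --> +oo.
  apply: nondecreasing_dvgn_lt; last exact: dvg_riemannR.
  by apply: nondecreasing_series => n _ _; rewrite ltW// riemannR_gt0.
move/cvgryPge => /(_ (B / c)); apply: filterS => n.
by rewrite ler_pdivrMr// mulrC.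
Qed.

End ScalarRecursion.

(** * Dirichlet energy of the communication graph *)

Section Energy.
Context {R : realType}.

Definition dot n (x y : 'cV[R]_n) : R := (x^T *m y) ord0 ord0.
Definition sqn n (x : 'cV[R]_n) : R := dot x x.

Lemma dotE n (x y : 'cV[R]_n) : dot x y = \sum_k x k ord0 * y k ord0.
Proof. by rewrite /dot mxE; apply: eq_bigr => k _; rewrite mxE. Qed.

Lemma sqnE n (x : 'cV[R]_n) : sqn x = \sum_k x k ord0 ^+ 2.
Proof. by rewrite /sqn dotE. Qed.

Lemma sqn_ge0 n (x : 'cV[R]_n) : 0 <= sqn x.
Proof. by rewrite sqnE sumr_ge0// => k _; rewrite sqr_ge0. Qed.

Lemma dotC n (x y : 'cV[R]_n) : dot x y = dot y x.
Proof. by rewrite !dotE; apply: eq_bigr => k _; rewrite mulrC. Qed.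

Lemma dotDr n (x y z : 'cV[R]_n) : dot x (y + z) = dot x y + dot x z.
Proof. by rewrite /dot mulmxDr mxE. Qed.

Lemma dotNr n (x y : 'cV[R]_n) : dot x (- y) = - dot x y.
Proof. by rewrite /dot mulmxN mxE. Qed.

Lemma dotZr n a (x y : 'cV[R]_n) : dot x (a *: y) = a * dot x y.
Proof. by rewrite /dot -scalemxAr mxE. Qed.

Lemma dot_sumr n (I : finType) (Q : pred I) (x : 'cV[R]_n) (f : I -> 'cV[R]_n) :
  dot x (\sum_(j | Q j) f j) = \sum_(j | Q j) dot x (f j).
Proof. by rewrite /dot mulmx_sumr summxE. Qed.

Lemma sqnD n (x y : 'cV[R]_n) : sqn (x + y) = sqn x + 2 * dot x y + sqn y.
Proof. by rewrite /sqn dotDr dotC dotDr (dotC (x + y)) dotDr (dotC y x); ring. Qed.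

Lemma sqnZ n a (x : 'cV[R]_n) : sqn (a *: x) = a ^+ 2 * sqn x.
Proof. by rewrite /sqn dotZr dotC dotZr; ring. Qed.

Lemma sqnN n (x : 'cV[R]_n) : sqn (- x) = sqn x.
Proof. by rewrite -scaleN1r sqnZ sqrrN expr1n mul1r. Qed.

Lemma sqnD_le n l (x y : 'cV[R]_n) : 0 < l ->
  sqn (x + y) <= (1 + l^-1) * sqn x + (1 + l) * sqn y.
Proof.
move=> l0; rewrite !sqnE !mulr_sumr -big_split; apply: ler_sum => k _.
by rewrite mxE sqrrD_le.
Qed.

Lemma sqnD_le2 n (x y : 'cV[R]_n) : sqn (x + y) <= 2 * sqn x + 2 * sqn y.
Proof. by have := sqnD_le x y (@ltr01 R); rewrite invr1. Qed.

(** Cauchy-Schwarz after extending [f] by zero outside [Q], so that the constant depends on [I]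
    alone. *)
Lemma sqr_sum_le (I : finType) (Q : pred I) (f : I -> R) :
  (\sum_(i | Q i) f i) ^+ 2 <= #|I|%:R * \sum_(i | Q i) f i ^+ 2.
Proof.
pose g i := if Q i then f i else 0.
have -> : \sum_(i | Q i) f i = \sum_i g i by rewrite big_mkcond.
have -> : \sum_(i | Q i) f i ^+ 2 = \sum_i g i ^+ 2.
  rewrite big_mkcond; apply: eq_bigr => i _; rewrite /g; case: ifP => //.
  by rewrite expr0n.
rewrite expr2 big_distrlr/=.
pose h i := g i ^+ 2 / 2.
apply: (@le_trans _ _ (\sum_i \sum_j (h i + h j))).
  apply: ler_sum => i _; apply: ler_sum => j _; rewrite /h.
  have := sqr_ge0 (g i - g j); nra.
rewrite (eq_bigr (fun i => h i *+ #|I| + \sum_j h j)); last first.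
  by move=> i _; rewrite big_split/= sumr_const.
rewrite big_split/= sumr_const sumrMnl -mulrnDl -[leLHS]mulr_natl -big_split/=.
rewrite le_eqVlt; apply/orP; left; apply/eqP; congr (_ * _).
by apply: eq_bigr => i _; rewrite /h; field.
Qed.

Lemma sqn_sum_le n (I : finType) (Q : pred I) (f : I -> 'cV[R]_n) :
  sqn (\sum_(i | Q i) f i) <= #|I|%:R * \sum_(i | Q i) sqn (f i).
Proof.
rewrite sqnE; under [X in _ * X]eq_bigr do rewrite sqnE.
rewrite exchange_big/= mulr_sumr; apply: ler_sum => k _.
by rewrite summxE; exact: sqr_sum_le.
Qed.

Lemma sqn_mulmx_le m n (B : 'M[R]_(m, n)) :
  exists2 K, 0 <= K & forall x, sqn (B *m x) <= K * sqn x.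
Proof.
exists (\sum_i (n%:R * \sum_j B i j ^+ 2)).
  by apply: sumr_ge0 => i _; rewrite mulr_ge0// sumr_ge0// => j _; rewrite sqr_ge0.
move=> x; rewrite [sqn (B *m x)]sqnE mulr_suml; apply: ler_sum => i _.
rewrite mxE; apply: le_trans (sqr_sum_le _ _) _; rewrite card_ord -mulrA ler_wpM2l//.
rewrite mulr_suml; apply: ler_sum => j _; rewrite exprMn ler_wpM2l ?sqr_ge0//.
by rewrite sqnE (bigD1 j)//= lerDl sumr_ge0// => k _; rewrite sqr_ge0.
Qed.

Lemma dot_gram m n (B : 'M[R]_(m, n)) (x : 'cV[R]_n) :
  dot x (B^T *m (B *m x)) = sqn (B *m x).
Proof. by rewrite /sqn /dot trmx_mul mulmxA. Qed.

End Energy.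

Section Graph.
Context {R : realType}.
Variables (N n : nat) (A : rel 'I_N).
Hypothesis Asym : forall i j, A i j = A j i.
Implicit Types u v : 'I_N -> 'cV[R]_n.

Definition lap u (i : 'I_N) : 'cV[R]_n := \sum_(j < N | A i j) (u i - u j).
(** The sum runs over ordered pairs, so each undirected edge counts twice; hence the factor 2 in
    [dot_lap]. *)
Definition dirichlet u : R := \sum_i \sum_(j < N | A i j) sqn (u i - u j).
Definition nsq u : R := \sum_i sqn (u i).

Lemma nsq_ge0 u : 0 <= nsq u.
Proof. by apply: sumr_ge0 => i _; exact: sqn_ge0. Qed.

Lemma dirichlet_ge0 u : 0 <= dirichlet u.
Proof. by apply: sumr_ge0 => i _; apply: sumr_ge0 => j _; exact: sqn_ge0. Qed.

(** Summation by parts: symmetry of [A] lets the two ends of an edge be exchanged, and the two forms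
    of the sum add up to squares of differences. *)
Lemma dot_lap u : 2 * \sum_i dot (u i) (lap u i) = dirichlet u.
Proof.
have E : \sum_i dot (u i) (lap u i) = \sum_i \sum_(j < N | A i j) dot (u i) (u i - u j).
  by apply: eq_bigr => i _; rewrite dot_sumr.
have E' : \sum_i dot (u i) (lap u i) = \sum_i \sum_(j < N | A i j) dot (u j) (u j - u i).
  rewrite E (exchange_big_dep xpredT)//=.
  by apply: eq_bigr => i _; apply: eq_bigl => j; rewrite Asym.
rewrite mulr_natl mulr2n {1}E E' -big_split/=; apply: eq_bigr => i _.
rewrite -big_split/=; apply: eq_bigr => j _.
rewrite sqnD sqnN !dotDr !dotNr /sqn (dotC (u j) (u i)); ring.
Qed.

Lemma nsq_lap_le u : nsq (lap u) <= N%:R * dirichlet u.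
Proof.
rewrite /nsq /dirichlet mulr_sumr; apply: ler_sum => i _.
by apply: le_trans (sqn_sum_le _ _) _; rewrite card_ord.
Qed.

Lemma dirichlet_edge_le u i j : A i j -> sqn (u i - u j) <= dirichlet u.
Proof.
move=> Aij; rewrite /dirichlet (bigD1 i)//= (bigD1 j)//= -addrA lerDl addr_ge0//.
  by apply: sumr_ge0 => k _; exact: sqn_ge0.
by apply: sumr_ge0 => k _; apply: sumr_ge0 => l _; exact: sqn_ge0.
Qed.

Hypothesis Aconn : forall i j, connect A i j.

(** Telescoping along a path from [i] to [j], each edge being controlled by the whole energy.
    Connectedness enters here, in place of the spectral gap. *)
Lemma poincare_pair i j :
  exists2 C, 0 <= C & forall u, sqn (u i - u j) <= C * dirichlet u.
Proof.
have /connectP[p] := Aconn i j; elim: p i => [|k p IH] i /=.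
  move=> _ ->; exists 0 => // u; rewrite subrr mul0r sqnE big1// => l _.
  by rewrite mxE expr0n.
move=> /andP[Aik pk] jk; have [C C0 hC] := IH k pk jk.
exists (2 + 2 * C) => [|u]; first by rewrite addr_ge0// mulr_ge0.
have -> : u i - u j = (u i - u k) + (u k - u j) by rewrite addrA subrK.
apply: (le_trans (sqnD_le2 _ _)).
have -> : (2 + 2 * C) * dirichlet u = 2 * dirichlet u + 2 * (C * dirichlet u) by ring.
by rewrite lerD// ler_pM2l// dirichlet_edge_le.
Qed.

Lemma poincare : exists2 C, 0 < C & forall u i j, sqn (u i - u j) <= C * dirichlet u.
Proof.
have /fin_all_exists2[C C0 hC] i := fin_all_exists2 (poincare_pair i).
exists (1 + \sum_i \sum_j C i j) => [|u i j].
  by rewrite ltr_pwDl// sumr_ge0// => i _; rewrite sumr_ge0// => j _.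
apply: (le_trans (hC i j u)); rewrite ler_wpM2r ?dirichlet_ge0//.
rewrite (bigD1 i)//= (bigD1 j)//= ler_wpDl// -addrA lerDl addr_ge0//.
  by rewrite sumr_ge0.
by rewrite sumr_ge0// => k _; rewrite sumr_ge0.
Qed.

End Graph.

(** * Energy descent and coercivity *)

Section EnergyDescent.
Context {R : realType}.
Variables (N n : nat) (A : rel 'I_N) (m : 'I_N -> nat).
Variable (H : forall i : 'I_N, 'M[R]_(m i, n)).
Hypothesis Asym : forall i j, A i j = A j i.
Implicit Types u v : 'I_N -> 'cV[R]_n.

Definition gram u (i : 'I_N) : 'cV[R]_n := (H i)^T *m (H i *m u i).
Definition obs_energy u : R := \sum_i sqn (H i *m u i).

Lemma obs_energy_ge0 u : 0 <= obs_energy u.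
Proof. by apply: sumr_ge0 => i _; exact: sqn_ge0. Qed.

Lemma nsq_gram_le : exists2 K, 0 <= K & forall u, nsq (gram u) <= K * nsq u.
Proof.
have /fin_all_exists2[K K0 hK] i := sqn_mulmx_le ((H i)^T *m H i).
exists (\sum_i K i) => [|u]; first exact: sumr_ge0.
rewrite /nsq mulr_sumr; apply: ler_sum => i _; rewrite /gram mulmxA.
apply: (le_trans (hK i _)); rewrite ler_wpM2r ?sqn_ge0//.
by rewrite (bigD1 i)//= lerDl sumr_ge0.
Qed.

Lemma nsqD_le l u v : 0 < l ->
  nsq (fun i => u i + v i) <= (1 + l^-1) * nsq u + (1 + l) * nsq v.
Proof.
move=> l0; rewrite /nsq !mulr_sumr -big_split; apply: ler_sum => i _.
exact: sqnD_le.
Qed.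

Lemma nsqZ c u : nsq (fun i => c *: u i) = c ^+ 2 * nsq u.
Proof. by rewrite /nsq mulr_sumr; apply: eq_bigr => i _; rewrite sqnZ. Qed.

(** Expanding the square, the cross term gains [be] times the Dirichlet energy plus [2 * al] times
    the observation energy. The bound on [be] lets half of the Dirichlet gain absorb the squared
    Laplacian term; since [al <= be], coercivity turns the rest into a gain [al / (2 * C)], half of
    which pays for the squared [gram] term. *)
Lemma nsq_descent (C K al be : R) u : 0 < C ->
  (forall u, nsq (gram u) <= K * nsq u) ->
  nsq u <= C * (dirichlet A u + obs_energy u) ->
  0 <= al <= be -> 4 * N%:R * be <= 1 -> 8 * C * K * al <= 1 ->
  nsq (fun i => u i - (be *: lap A u i + al *: gram u i)) <= (1 - al / (4 * C)) * nsq u.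
Proof.
move=> C0 hK hC /andP[al0 albe] beN alK.
pose v i := be *: lap A u i + al *: gram u i.
have -> : nsq (fun i => u i - v i) = nsq u - 2 * (\sum_i dot (u i) (v i)) + nsq v.
  rewrite /nsq mulr_sumr -sumrN -!big_split/=; apply: eq_bigr => i _.
  by rewrite sqnD sqnN dotNr; ring.
have -> : \sum_i dot (u i) (v i) = be * (\sum_i dot (u i) (lap A u i)) + al * obs_energy u.
  rewrite /obs_energy !mulr_sumr -big_split/=; apply: eq_bigr => i _.
  by rewrite dotDr !dotZr dot_gram.
have vle : nsq v <= 2 * (be ^+ 2 * (N%:R * dirichlet A u)) + 2 * (al ^+ 2 * (K * nsq u)).
  have := nsqD_le (fun i => be *: lap A u i) (fun i => al *: gram u i) (@ltr01 R).
  rewrite invr1 !nsqZ => /le_trans; apply.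
  rewrite lerD// ler_wpM2l// ler_wpM2l ?sqr_ge0//.
  exact: nsq_lap_le.
have := dot_lap Asym u; move: vle hC (dirichlet_ge0 A u) (obs_energy_ge0 u) (nsq_ge0 u).
move: (nsq v) (\sum_i dot _ _) (dirichlet A u) (obs_energy u) (nsq u) => V S E F U.
move=> hV hU E0 F0 U0 hS.
have be0 : 0 <= be by exact: le_trans albe.
have h1 : be * E * (4 * N%:R * be) <= be * E by rewrite ler_piMr// mulr_ge0.
have h2 : al * U * (8 * C * K * al) <= al * U by rewrite ler_piMr// mulr_ge0.
have h2' : 2 * (al ^+ 2 * (K * U)) <= al * U / (4 * C).
  rewrite ler_pdivlMr ?mulr_gt0//.
  by apply: le_trans h2; rewrite le_eqVlt; apply/orP; left; apply/eqP; ring.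
have h3 : al * E <= be * E by rewrite ler_wpM2r.
have h4 : al * U / (2 * C) <= al * (E + F) / 2.
  rewrite ler_pdivrMr ?mulr_gt0//.
  have -> : al * (E + F) / 2 * (2 * C) = al * (C * (E + F)) by field.
  by rewrite ler_wpM2l.
have h5 : 0 <= al * F by rewrite mulr_ge0.
have -> : (1 - al / (4 * C)) * U = U + al * U / (4 * C) - al * U / (2 * C).
  by field; rewrite gt_eqF.
nra.
Qed.

(** Young's inequality with weight [c * al t] separates the perturbation: it costs half of the
    descent rate and leaves a forcing of order [al t * nsq (xi t)], the same order in [al t] as the
    contraction. *)
Lemma nsq_cvg0_of_descent (C : R) (u xi : nat -> 'I_N -> 'cV[R]_n) (al be : nat -> R) :
  0 < C ->
  (forall t, nsq (u t) <= C * (dirichlet A (u t) + obs_energy (u t))) ->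
  (forall t i, u t.+1 i = u t i - (be t *: lap A (u t) i + al t *: gram (u t) i)
     + al t *: xi t i) ->
  (forall t, 0 < al t) -> (\forall t \near \oo, al t <= be t) ->
  be @ \oo --> (0 : R) -> series al @ \oo --> +oo ->
  (fun t => nsq (xi t)) @ \oo --> (0 : R) ->
  (fun t => nsq (u t)) @ \oo --> (0 : R).
Proof.
move=> C0 hC rec al0 albe be0 aly xi0.
have [K K0 hK] := nsq_gram_le.
(* Half of the descent rate [1 / (4 * C)], the other half being spent in Young's inequality. *)
pose c := (8 * C)^-1.
have c0 : 0 < c by rewrite invr_gt0 mulr_gt0.
have small (e : R) : 0 < e -> \forall t \near \oo, be t <= e.
  move=> e0; move/cvgrPdist_le : be0 => /(_ _ e0); apply: filterS => t.
  by rewrite sub0r normrN; exact: le_trans (ler_norm _).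
have smallM (e : R) : 0 <= e -> \forall t \near \oo, e * be t <= 1.
  move=> e0; have e1 : 0 < (e + 1)^-1 by rewrite invr_gt0 ltr_wpDl.
  have := small _ e1; apply: filter_app; have := albe; apply: filterS => t abt h.
  have bt : 0 <= be t by apply: le_trans abt; exact: ltW.
  have := ler_wpM2l (ltW (ltr_wpDl e0 ltr01)) h; rewrite divff ?gt_eqF ?ltr_wpDl//.
  by apply: le_trans; rewrite ler_wpM2r// lerDl.
have hc := smallM c (ltW c0); have h1 := smallM 1 ler01.
have hN := smallM (4 * N%:R) (mulr_ge0 (ler0n _ _) (ler0n _ _)).
have hKC := smallM (8 * C * K) (mulr_ge0 (mulr_ge0 (ler0n _ _) (ltW C0)) K0).
(* The forcing coefficient is [al t ^+ 2 + al t / c]; once [al t <= 1] it is at most [c * al t]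
   times [(1 + c^-1) / c]. *)
apply: (@cvg0_of_contraction _ _ (fun t => c * al t)
  (fun t => (1 + c^-1) / c * nsq (xi t))).
- by move=> t; exact: nsq_ge0.
- near=> t; apply/andP; split; first by rewrite mulr_ge0// ltW.
  apply: (@le_trans _ _ (c * be t)); last by near: t.
  by rewrite ler_wpM2l ?(ltW c0)//; near: t.
- near=> t.
  have abt : al t <= be t by near: t.
  have at0 := al0 t.
  have l0 : 0 < c * al t by rewrite mulr_gt0.
  pose phi i := u t i - (be t *: lap A (u t) i + al t *: gram (u t) i).
  have -> : nsq (u t.+1) = nsq (fun i => al t *: xi t i + phi i).
    by apply: eq_bigr => i _; rewrite rec addrC.
  apply: (le_trans (nsqD_le _ _ l0)); rewrite nsqZ.
  have hphi : nsq phi <= (1 - 2 * (c * al t)) * nsq (u t).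
    have -> : 2 * (c * al t) = al t / (4 * C) by rewrite /c; field; rewrite gt_eqF.
    apply: nsq_descent hK (hC t) _ _ _ => //.
    + by rewrite (ltW at0).
    + by near: t.
    + apply: (@le_trans _ _ (8 * C * K * be t)); last by near: t.
      by rewrite ler_wpM2l// !mulr_ge0// ltW.
  have at1 : al t <= 1.
    by apply: (le_trans abt); rewrite -[leLHS]mul1r; near: t.
  move: hphi (nsq_ge0 phi) (nsq_ge0 (u t)) (nsq_ge0 (xi t)).
  move: (nsq phi) (nsq (u t)) (nsq (xi t)) => F U X hF F0 U0 X0.
  rewrite addrC lerD//.
    apply: (@le_trans _ _ ((1 + c * al t) * ((1 - 2 * (c * al t)) * U))).
      by rewrite ler_wpM2l// addr_ge0// ltW.
    have -> : (1 + c * al t) * ((1 - 2 * (c * al t)) * U) =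
      (1 - c * al t) * U - 2 * ((c * al t) ^+ 2 * U) by ring.
    by rewrite gerBl mulr_ge0// mulr_ge0// sqr_ge0.
  have -> : (1 + (c * al t)^-1) * (al t ^+ 2 * X) = (al t * al t + al t / c) * X.
    by field; rewrite !gt_eqF.
  have -> : c * al t * ((1 + c^-1) / c * X) = (al t + al t / c) * X.
    by field; rewrite gt_eqF.
  by rewrite ler_wpM2r// lerD2r ler_piMr// ltW.
- apply/cvgryPge => B; move/cvgryPge : aly => /(_ (B / c)); apply: filterS => t.
  have -> : series (fun t => c * al t) t = c * series al t by rewrite /series/= mulr_sumr.
  by rewrite ler_pdivrMr// mulrC.
- rewrite -(mulr0 ((1 + c^-1) / c)); exact: cvgMr.
Unshelve. all: by end_near. Qed.

Hypothesis Aconn : forall i j, connect A i j.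

(** When the sum vanishes, [N%:R *: u j] is the sum of the differences [u j - u i], which the
    Poincare inequality controls. *)
Lemma coercive_of_sum0 : exists2 C, 0 < C &
  forall u, \sum_i u i = 0 -> nsq u <= C * dirichlet A u.
Proof.
have [C C0 hC] := poincare (R := R) n Aconn.
exists (N%:R * C + 1) => [|u u0]; first by rewrite ltr_wpDl// mulr_ge0// ltW.
apply: (@le_trans _ _ (N%:R * C * dirichlet A u)); last first.
  by rewrite ler_wpM2r ?dirichlet_ge0// lerDl.
apply: (@le_trans _ _ (\sum_(j < N) (C * dirichlet A u))); last first.
  by rewrite sumr_const card_ord -mulrA mulr_natl.
rewrite /nsq; apply: ler_sum => j _.
have N0 : 0 < N%:R :> R by rewrite ltr0n; case: (N) j => // -[].
have uj : N%:R *: u j = \sum_i (u j - u i).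
  by rewrite sumrB u0 subr0 sumr_const card_ord scaler_nat.
have : sqn (N%:R *: u j) <= N%:R * \sum_(i < N) (C * dirichlet A u).
  rewrite uj; apply: (le_trans (sqn_sum_le _ _)); rewrite card_ord ler_wpM2l//.
  by apply: ler_sum => i _; exact: hC.
rewrite sqnZ sumr_const card_ord -[C * _ *+ _]mulr_natl mulrA -expr2 ler_pM2l//.
exact: exprn_gt0.
Qed.

(** Inverting [G] bounds a single vector by its images under all the [H i]. For the vector [u j],
    the image [H i *m u j] is [H i *m u i], seen by the observation energy, plus a difference
    between agents, seen by the Dirichlet energy. *)
Lemma coercive_of_full_rank : \rank (\sum_(i < N) (H i)^T *m H i)%R = n ->
  exists2 C, 0 < C & forall u, nsq u <= C * (dirichlet A u + obs_energy u).
Proof.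
set G := \sum_(i < N) _ => rG.
have Gu : G \in unitmx by rewrite -row_free_unit /row_free rG.
have [Kp Kp0 hKp] := poincare (R := R) n Aconn.
have [Ki Ki0 hKi] := sqn_mulmx_le (invmx G).
have /fin_all_exists2[Kt Kt0 hKt] i := sqn_mulmx_le (H i)^T.
have /fin_all_exists2[Kh Kh0 hKh] i := sqn_mulmx_le (H i).
pose T := \sum_i Kt i; pose S := \sum_i Kh i.
have T0 : 0 <= T by exact: sumr_ge0.
have S0 : 0 <= S by exact: sumr_ge0.
have TE i : Kt i <= T by rewrite /T (bigD1 i)//= lerDl sumr_ge0.
have obs x : sqn x <= Ki * (N%:R * (T * \sum_i sqn (H i *m x))).
  rewrite -[x in sqn x](mulKmx Gu); apply: (le_trans (hKi _)); rewrite ler_wpM2l//.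
  rewrite mulmx_suml; apply: (le_trans (sqn_sum_le _ _)).
  rewrite card_ord ler_wpM2l// mulr_sumr; apply: ler_sum => i _.
  by rewrite -mulmxA; apply: (le_trans (hKt i _)); rewrite ler_wpM2r ?sqn_ge0.
have each u j : sqn (u j) <= Ki * (N%:R * (T * (2 * obs_energy u + 2 * (S * (Kp * dirichlet A u))))).
  move: (dirichlet A u) (hKp u) => D hD.
  apply: (le_trans (obs _)); do 3 rewrite ler_wpM2l//.
  rewrite /obs_energy /S mulr_suml !mulr_sumr -big_split/=; apply: ler_sum => i _.
  have -> : H i *m u j = H i *m u i + H i *m (u j - u i) by rewrite -mulmxDr addrC subrK.
  apply: (le_trans (sqnD_le2 _ _)); rewrite lerD2l ler_wpM2l//.
  by apply: (le_trans (hKh i _)); rewrite ler_wpM2l.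
have SK : 0 <= S * Kp by rewrite mulr_ge0// ltW.
have B0 : 0 <= 2 + 2 * (S * Kp) by rewrite addr_ge0// mulr_ge0.
exists (N%:R * (Ki * (N%:R * (T * (2 + 2 * (S * Kp))))) + 1) => [|u].
  by rewrite ltr_wpDl// mulr_ge0// mulr_ge0// mulr_ge0// mulr_ge0.
apply: (@le_trans _ _ (\sum_(j < N)
    Ki * (N%:R * (T * (2 * obs_energy u + 2 * (S * (Kp * dirichlet A u))))))).
  by apply: ler_sum => j _; exact: each.
rewrite sumr_const card_ord -[leLHS]mulr_natl.
have D0 := dirichlet_ge0 A u; have O0 := obs_energy_ge0 u.
apply: (@le_trans _ _ (N%:R * (Ki * (N%:R * (T * (2 + 2 * (S * Kp))))) *
    (dirichlet A u + obs_energy u))); last by rewrite ler_wpM2r ?addr_ge0// lerDl.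
have -> : N%:R * (Ki * (N%:R * (T * (2 + 2 * (S * Kp))))) * (dirichlet A u + obs_energy u) =
  N%:R * (Ki * (N%:R * (T * ((2 + 2 * (S * Kp)) * (dirichlet A u + obs_energy u))))) by ring.
do 4 rewrite ler_wpM2l//.
have -> : (2 + 2 * (S * Kp)) * (dirichlet A u + obs_energy u) =
  2 * obs_energy u + 2 * (S * (Kp * dirichlet A u))
  + (2 * dirichlet A u + 2 * (S * Kp * obs_energy u)) by ring.
by rewrite lerDl addr_ge0// mulr_ge0// mulr_ge0.
Qed.

End EnergyDescent.

(** * The estimator along one noise realization *)

Section Pathwise.
Context {R : realType}.

Lemma cvg_sum (I : Type) (r : seq I) (Q : pred I) (f : I -> nat -> R) (l : I -> R) :
  (forall i, Q i -> f i @ \oo --> l i) ->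
  (fun t => \sum_(i <- r | Q i) f i t) @ \oo --> \sum_(i <- r | Q i) l i.
Proof. by move=> fl; apply: cvg_big => //; exact: add_continuous. Qed.

Lemma nsq_cvg0 N n (f : nat -> 'I_N -> 'cV[R]_n) :
  (forall i k, (fun t => f t i k ord0) @ \oo --> (0 : R)) ->
  (fun t => nsq (f t)) @ \oo --> (0 : R).
Proof.
move=> hf; rewrite (_ : (fun t => _) = fun t => \sum_i \sum_k (f t i k ord0) ^+ 2); last first.
  by apply/funext => t; apply: eq_bigr => i _; rewrite sqnE.
have z0 : \sum_(i < N) \sum_(k < n) 0 ^+ 2 = 0 :> R.
  by rewrite big1// => i _; rewrite big1// => k _; rewrite expr0n.
rewrite -[X in _ --> X]z0.
apply: cvg_sum => i _; apply: cvg_sum => k _.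
under eq_fun do rewrite expr2.
by rewrite expr2; apply: cvgM.
Qed.

Lemma nsq_cvg0_coord N n (f : nat -> 'I_N -> 'cV[R]_n) i k :
  (fun t => nsq (f t)) @ \oo --> (0 : R) ->
  (fun t => f t i k ord0) @ \oo --> (0 : R).
Proof.
move=> hf; apply/cvgrPdist_le => e e0.
have e20 : 0 < e ^+ 2 by rewrite exprn_gt0.
move/cvgrPdist_le : hf => /(_ _ e20); apply: filterS => t.
rewrite !sub0r !normrN ger0_norm ?nsq_ge0// => fe.
rewrite -(@ler_pXn2r _ 2)// ?nnegrE ?(ltW e0)// real_normK ?num_real//.
apply: le_trans fe; rewrite /nsq (bigD1 i)//= sqnE (bigD1 k)//= -addrA lerDl.
by rewrite addr_ge0// sumr_ge0// => j _; [exact: sqr_ge0|exact: sqn_ge0].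
Qed.

Lemma cvg_mulmx_coord p n (B : 'M[R]_(p, n)) (f : nat -> 'cV[R]_n) (l : 'cV[R]_n) k :
  (forall j, (fun t => f t j ord0) @ \oo --> l j ord0) ->
  (fun t => (B *m f t) k ord0) @ \oo --> (B *m l) k ord0.
Proof.
move=> hf; rewrite mxE; under eq_fun do rewrite mxE.
by apply: cvg_sum => j _; apply: cvgMr.
Qed.

Lemma cvg_col_coord n (f : nat -> 'cV[R]_n) (l : 'cV[R]_n) :
  (forall k, (fun t => f t k ord0) @ \oo --> l k ord0) -> f @ \oo --> l.
Proof.
move=> hf; apply/cvg_ballP => e e0.
have : \forall t \near \oo, forall k, ball (l k ord0) e (f t k ord0).
  by apply: filter_forall => k; move/cvg_ballP : (hf k); exact.
by apply: filterS => t h; split=> // i j; rewrite (ord1 j).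
Qed.

(** The input carries the factor [be], so that this recursion has the shape of [nsq_cvg0_of_descent]
    with both step sizes equal to [be]. *)
Fixpoint lap_flow N n (A : rel 'I_N) (be : nat -> R) (z : nat -> 'I_N -> 'cV[R]_n)
    (t : nat) : 'I_N -> 'cV[R]_n :=
  if t is t'.+1 then
    fun i => lap_flow A be z t' i - be t' *: lap A (lap_flow A be z t') i + be t' *: z t' i
  else fun=> 0.

Lemma sum_lap N n (A : rel 'I_N) (u : 'I_N -> 'cV[R]_n) :
  (forall i j, A i j = A j i) -> \sum_i lap A u i = 0.
Proof.
move=> Asym; rewrite /lap; under eq_bigr do rewrite sumrB.
rewrite sumrB [X in X - _](exchange_big_dep xpredT)//=.
apply/eqP; rewrite subr_eq0; apply/eqP; apply: eq_bigr => i _.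
by apply: eq_bigl => j; rewrite Asym.
Qed.

Lemma lap_flow_cvg0 N n (A : rel 'I_N) (be : nat -> R) (z : nat -> 'I_N -> 'cV[R]_n) :
  (forall i j, A i j = A j i) -> (forall i j, connect A i j) ->
  (forall t, 0 < be t) -> be @ \oo --> (0 : R) -> series be @ \oo --> +oo ->
  (forall t, \sum_i z t i = 0) ->
  (fun t => nsq (z t)) @ \oo --> (0 : R) ->
  (fun t => nsq (lap_flow A be z t)) @ \oo --> (0 : R).
Proof.
move=> Asym Aconn be0 bec bey z0 zc.
have sum0 t : \sum_i lap_flow A be z t i = 0.
  elim: t => [|t IH] /=; first by rewrite big1.
  by rewrite big_split/= sumrB -!scaler_sumr IH z0 sum_lap// !scaler0 subr0 addr0.
have [C C0 hC] := coercive_of_sum0 (R := R) n Aconn.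
(* Observation matrices with no rows make [gram] vanish; the preserved zero sum supplies coercivity
   from the Dirichlet energy alone. *)
apply: (@nsq_cvg0_of_descent _ _ _ _ (fun=> 0%N) (fun=> 0) Asym C _ z be be) => //.
- move=> t; apply: (le_trans (hC _ (sum0 t))).
  by rewrite ler_wpM2l ?(ltW C0)// lerDl obs_energy_ge0.
- by move=> t i; rewrite /gram mul0mx mulmx0 scaler0 addr0.
- by near=> t.
Unshelve. all: by end_near. Qed.

(** * Decomposition of the estimation error *)

Section Estimator.
Variables (N n : nat) (m : 'I_N -> nat) (H : forall i : 'I_N, 'M[R]_(m i, n)).
Variables (theta : 'cV[R]_n) (A : rel 'I_N) (rho : 'I_N -> R) (x0 : 'I_N -> 'cV[R]_n).
Variables (a b tau1 tau2 : R) (vw : nat -> forall i : 'I_N, 'cV[R]_(m i)).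
Hypotheses (Asym : forall i j, A i j = A j i) (Aconn : forall i j, connect A i j).
Hypothesis rankG : \rank (\sum_(i < N) (H i)^T *m H i)%R = n.
Hypotheses (a0 : 0 < a) (b0 : 0 < b) (tau20 : 0 < tau2) (tau21 : tau2 < tau1) (tau11 : tau1 <= 1).
Hypothesis rho_gt : forall j, tau1 - tau2 < rho j.
Hypothesis vw_series : forall i k, cvgn (series (fun t => step a tau1 t * vw t i k ord0)).
Hypothesis vw_small : forall i k,
  (fun t : nat => t.+1%:R `^ (- (tau1 - tau2)) * vw t i k ord0) @ \oo --> (0 : R).

Let al := step a tau1.
Let be := step b tau2.
Let W t i : 'cV[R]_n := (H i)^T *m vw t i.
Let Wb t : 'cV[R]_n := N%:R^-1 *: \sum_i W t i.
Let x := estimate H theta A rho al be x0 vw.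
Let zp t := (est_state H theta A rho al be x0 vw t).2.
Let sent t := transmitted rho t (x t) (zp t).
Let delta t j := sent t j - x t j.

Lemma estimateS t i :
  x t.+1 i = x t i + al t *: ((H i)^T *m (meas H theta vw t i - H i *m x t i))
    + be t *: \sum_(j < N | A i j) (sent t j - x t i).
Proof.
by rewrite /sent /zp /x /estimate /=; case: (est_state _ _ _ _ _ _ _ _ t).
Qed.

(** Either the agent has just triggered and the gap is zero, or the failed test is itself the
    bound. *)
Lemma delta_le t j k : `|delta t j k ord0| <= t.+1%:R `^ (- rho j).
Proof.
rewrite /delta /sent /transmitted powRN -/(threshold (rho j) t).
case: ifPn => [_|].
  by rewrite subrr mxE normr0 invr_ge0 powR_ge0.
rewrite -leNgt; apply: le_trans; rewrite /enorm -sqrtr_sqr ler_wsqrtr//.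
rewrite (bigD1 k)//= !mxE -[in leLHS]sqrrN opprB lerDl sumr_ge0// => l _.
exact: sqr_ge0.
Qed.

Lemma step_gt0 (c tau : R) t : 0 < c -> 0 < step c tau t.
Proof. by move=> c0; rewrite divr_gt0// powR_gt0. Qed.

Lemma step_cvg0 (c tau : R) : 0 < tau -> step c tau @ \oo --> (0 : R).
Proof.
move=> t0; rewrite (_ : step c tau = fun t => c * t.+1%:R `^ (- tau)); last first.
  by apply/funext => t; rewrite /step powRN.
by rewrite -[X in _ --> X](mulr0 c); apply: cvgMr; exact: cvg_natS_powRN.
Qed.

Lemma step_ratio t : al t / be t = a / b * t.+1%:R `^ (- (tau1 - tau2)).
Proof.
have t0 : 0 < t.+1%:R :> R by rewrite ltr0n.
have h1 : 0 < t.+1%:R `^ tau1 by rewrite powR_gt0.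
have h2 : 0 < t.+1%:R `^ tau2 by rewrite powR_gt0.
rewrite opprB powRB ?(gt_eqF t0) ?implybT// /al /be /step.
by field; rewrite !gt_eqF.
Qed.

Lemma step_le_near : \forall t \near \oo, al t <= be t.
Proof.
have : (fun t => al t / be t) @ \oo --> (0 : R).
  rewrite (_ : (fun t => _) = fun t => a / b * t.+1%:R `^ (- (tau1 - tau2))); last first.
    by apply/funext => t; rewrite step_ratio.
  by rewrite -[X in _ --> X](mulr0 (a / b)); apply: cvgMr; apply: cvg_natS_powRN; rewrite subr_gt0.
move/cvgrPdist_le => /(_ 1 ltr01); apply: filterS => t.
rewrite sub0r normrN => /(le_trans (ler_norm _)).
by rewrite ler_pdivrMr ?mul1r// step_gt0.
Qed.

Let Wr t i := (al t / be t) *: (W t i - Wb t).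
Let p := lap_flow A be Wr.
Let S t : 'cV[R]_n := \sum_(0 <= s < t) al s *: Wb s.

Lemma N_gt0 (i : 'I_N) : 0 < N%:R :> R.
Proof. by rewrite ltr0n; apply: leq_ltn_trans (ltn_ord i). Qed.

Lemma W_small i k : (fun t => ((al t / be t) *: W t i) k ord0) @ \oo --> (0 : R).
Proof.
have := @cvg_mulmx_coord _ _ (H i)^T (fun t => (al t / be t) *: vw t i) 0 k.
rewrite mulmx0 mxE; under [in X in _ -> X]eq_fun do rewrite scalemxAr.
apply => j; rewrite mxE.
rewrite (_ : (fun t => _) = fun t =>
   a / b * (t.+1%:R `^ (- (tau1 - tau2)) * vw t i j ord0)); last first.
  by apply/funext => t; rewrite mxE step_ratio mulrA.
by rewrite -[X in _ --> X](mulr0 (a / b)); apply: cvgMr.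
Qed.

Lemma Wb_small k : (fun t => ((al t / be t) *: Wb t) k ord0) @ \oo --> (0 : R).
Proof.
rewrite (_ : (fun t => _) = fun t =>
   N%:R^-1 * \sum_i (((al t / be t) *: W t i) k ord0)); last first.
  by apply/funext => t; rewrite /Wb scalerA mulrC -scalerA mxE scaler_sumr summxE.
have z0 : N%:R^-1 * \sum_(i < N) 0 = 0 :> R by rewrite big1 ?mulr0.
rewrite -[X in _ --> X]z0.
by apply: cvgMr; apply: cvg_sum => i _; exact: W_small.
Qed.

(** The input of the flow has zero sum, as [Wb] is the mean over agents ([i0] gives [N > 0]), and
    tends to 0 by [W_small] and [Wb_small]. *)
Lemma p_cvg0 (i0 : 'I_N) : (fun t => nsq (p t)) @ \oo --> (0 : R).
Proof.
apply: lap_flow_cvg0 => //.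
- by move=> t; exact: step_gt0.
- exact: step_cvg0.
- by apply: series_step_dvg => //; rewrite (ltW tau20) (le_trans (ltW tau21) tau11).
- move=> t; rewrite -scaler_sumr sumrB sumr_const card_ord /Wb.
  by rewrite -scaler_nat scalerA divff ?gt_eqF ?(N_gt0 i0)// scale1r subrr scaler0.
- apply: nsq_cvg0 => i k; rewrite -[X in _ --> X](subr0 0).
  rewrite (_ : (fun t => _) = fun t =>
     ((al t / be t) *: W t i) k ord0 - ((al t / be t) *: Wb t) k ord0); last first.
    by apply/funext => t; rewrite /Wr scalerBr !mxE.
  by apply: cvgB; [exact: W_small|exact: Wb_small].
Qed.

(** A fixed finite linear combination of the scalar noise series, each convergent by [vw_series]. *)
Lemma S_cvg k : cvgn (fun t => S t k ord0).
Proof.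
rewrite (_ : (fun t => _) = fun t => N%:R^-1 *
    \sum_i \sum_l (H i)^T k l * series (fun s => al s * vw s i l ord0) t); last first.
  apply/funext => t; rewrite /S summxE /series/=.
  under [in RHS]eq_bigr do under eq_bigr do rewrite mulr_sumr.
  under [in RHS]eq_bigr do rewrite exchange_big.
  rewrite exchange_big/= mulr_sumr; apply: eq_bigr => s _.
  rewrite mxE /Wb mxE mulrCA summxE; congr (_ * _); rewrite mulr_sumr.
  apply: eq_bigr => i _; rewrite mxE mulr_sumr; apply: eq_bigr => l _.
  by rewrite mulrCA.
apply: is_cvgMr; apply: cvgP; apply: cvg_sum => i _; apply: cvg_sum => l _.
by apply: cvgMr; exact: vw_series.
Qed.

Let r t : 'cV[R]_n := (\col_k limn (fun t => S t k ord0)) - S t.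

Lemma r_cvg0 k : (fun t => r t k ord0) @ \oo --> (0 : R).
Proof.
rewrite -[X in _ --> X](subrr (limn (fun t => S t k ord0))).
rewrite (_ : (fun t => _) = fun t => limn (fun t => S t k ord0) - S t k ord0); last first.
  by apply/funext => t; rewrite !mxE.
by apply: cvgB; [exact: cvg_cst|exact: S_cvg].
Qed.

Let xi t i := - ((H i)^T *m (H i *m (p t i - r t)))
  + (be t / al t) *: \sum_(j < N | A i j) delta t j.

(** The observation part vanishes with [p] and [r]. A triggering gap amplified by [be t / al t]
    decays with exponent [rho j - (tau1 - tau2)], positive by [rho_gt]. *)
Lemma xi_cvg0 : (fun t => nsq (xi t)) @ \oo --> (0 : R).
Proof.
apply: nsq_cvg0 => i k.
rewrite (_ : (fun t => _) = fun t => - (((H i)^T *m H i) *m (p t i - r t)) k ord0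
    + \sum_(j < N | A i j) (be t / al t * delta t j k ord0)); last first.
  by apply/funext => t; rewrite /xi mulmxA !mxE summxE mulr_sumr.
have z0 : - (((H i)^T *m H i) *m (0 : 'cV[R]_n)) k ord0 + \sum_(j < N | A i j) 0 = 0 :> R.
  by rewrite mulmx0 mxE big1// oppr0 addr0.
rewrite -[X in _ --> X]z0.
apply: cvgD.
  apply: cvgN; apply: (@cvg_mulmx_coord _ _ ((H i)^T *m H i) (fun t => p t i - r t)).
  move=> j; rewrite mxE (_ : (fun t => _) = fun t => p t i j ord0 - r t j ord0); last first.
    by apply/funext => t; rewrite !mxE.
  rewrite -[X in _ --> X](subr0 0); apply: cvgB; last exact: r_cvg0.
  exact: nsq_cvg0_coord (p_cvg0 i).
apply: cvg_sum => j _; apply/norm_cvg0P.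
apply: (@squeeze_cvgr _ _ _ _ (cst 0)
  (fun t : nat => b / a * t.+1%:R `^ (- (rho j - (tau1 - tau2))))).
- near=> t.
  have q0 : 0 <= be t / al t by rewrite divr_ge0// ltW// step_gt0.
  have t0 : 0 < t.+1%:R :> R by rewrite ltr0n.
  apply/andP; split; first exact: normr_ge0.
  rewrite normrM (ger0_norm q0).
  apply: (le_trans (ler_wpM2l q0 (delta_le t j k))).
  have -> : - (rho j - (tau1 - tau2)) = - rho j - - (tau1 - tau2) by ring.
  rewrite powRB ?(gt_eqF t0) ?implybT// -(invrK (be t / al t)) invf_div step_ratio.
  have : 0 < t.+1%:R `^ (- (tau1 - tau2)) by rewrite powR_gt0.
  move: (t.+1%:R `^ (- (tau1 - tau2))) (t.+1%:R `^ (- rho j)) => z y z_gt0.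
  by rewrite le_eqVlt; apply/orP; left; apply/eqP; field; rewrite !gt_eqF.
- exact: cvg_cst.
- rewrite -[X in _ --> X](mulr0 (b / a)); apply: cvgMr; apply: cvg_natS_powRN.
  by rewrite subr_gt0.
Unshelve. all: by end_near. Qed.

(* [p] absorbs the part of the noise that is orthogonal to consensus, and [r]
   (the same for all agents, hence invisible to the Laplacian) its average;
   what is left is driven only by the perturbation [al t *: xi t] with [xi] -> 0. *)
Let u t i := x t i - theta - p t i + r t.

(** The noise cancels: [al t] multiplies [W t i] from [x], [- (W t i - Wb t)] from [p] and [- Wb t]
    from [r]. *)
Lemma u_rec t i : u t.+1 i = u t i - (be t *: lap A (u t) i + al t *: gram H (u t) i)
  + al t *: xi t i.
Proof.
have al0 : al t != 0 by rewrite gt_eqF// step_gt0.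
have be0 : be t != 0 by rewrite gt_eqF// step_gt0.
have rS : r t.+1 = r t - al t *: Wb t.
  by rewrite /r /S big_nat_recr//= opprD addrA.
have pS : p t.+1 i = p t i - be t *: lap A (p t) i + al t *: (W t i - Wb t).
  by rewrite /p /= /Wr scalerA mulrCA mulfV// mulr1.
have xS : x t.+1 i = x t i - al t *: ((H i)^T *m (H i *m (x t i - theta)))
   + al t *: W t i + be t *: \sum_(j < N | A i j) delta t j - be t *: lap A (x t) i.
  rewrite estimateS -[RHS]addrA -scalerBr -sumrB; congr (_ + _ *: _); last first.
    apply: eq_bigr => j _; rewrite /delta.
    by apply/matrixP => k l; rewrite !mxE; ring.
  rewrite -[RHS]addrA; congr (_ + _).
  have -> : meas H theta vw t i - H i *m x t i = vw t i - H i *m (x t i - theta).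
    by rewrite /meas mulmxBr opprB addrA [vw t i + _]addrC.
  by rewrite mulmxBr scalerBr addrC.
have lapE : lap A (u t) i = lap A (x t) i - lap A (p t) i.
  rewrite /lap -sumrB; apply: eq_bigr => j _; rewrite /u.
  by apply/matrixP => k l; rewrite !mxE; ring.
have gramE : gram H (u t) i = (H i)^T *m (H i *m (x t i - theta)) - (H i)^T *m (H i *m (p t i - r t)).
  rewrite /gram -!mulmxBr; congr (_ *m (_ *m _)); rewrite /u.
  by apply/matrixP => k l; rewrite !mxE; ring.
have xiE : al t *: xi t i = - (al t *: ((H i)^T *m (H i *m (p t i - r t))))
   + be t *: \sum_(j < N | A i j) delta t j.
  by rewrite /xi scalerDr scalerN scalerA mulrCA mulfV// mulr1.
rewrite lapE gramE xiE /u xS pS rS.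
move: (_ *m _) (_ *m _) (lap _ _ _) (lap _ _ _) (\sum_(j < N | _) _) => g1 g2 l1 l2 sd.
by apply/matrixP => k l; rewrite !mxE; ring.
Qed.

Lemma estimate_cvg i : (fun t => x t i) @ \oo --> theta.
Proof.
have [C C0 hC] := coercive_of_full_rank Aconn rankG.
have uc : (fun t => nsq (u t)) @ \oo --> (0 : R).
  apply: (@nsq_cvg0_of_descent _ _ _ _ _ H Asym C u xi al be) => //.
  - exact: u_rec.
  - by move=> t; exact: step_gt0.
  - exact: step_le_near.
  - exact: step_cvg0.
  - by apply: series_step_dvg => //; rewrite tau11 (ltW (lt_trans tau20 tau21)).
  - exact: xi_cvg0.
apply: cvg_col_coord => k.
rewrite (_ : (fun t => _) = fun t => u t i k ord0 + p t i k ord0 - r t k ord0 + theta k ord0); last first.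
  by apply/funext => t; rewrite /u !mxE; ring.
rewrite -[X in _ --> X]add0r -{1}(subr0 0) -{1}(addr0 0); apply: cvgD; last exact: cvg_cst.
apply: cvgB; last exact: r_cvg0.
by apply: cvgD; apply: nsq_cvg0_coord => //; exact: (p_cvg0 i).
Qed.

End Estimator.
End Pathwise.

(** * Coordinates of the noise *)

Section NoiseCoordinates.
Context d (T : measurableType d) (R : realType) (P : probability T R).
Variables (N : nat) (m : 'I_N -> nat) (v : nat -> T -> forall i : 'I_N, 'cV[R]_(m i)).

(** Constrains one scalar coordinate, to pass from joint laws to marginals. Indices are compared
    through [val] because [k] and [k'] have different types until [i' = i] is known. *)
Definition coord_rect (i : 'I_N) (k : 'I_(m i)) (B : set R)
    (i' : 'I_N) (k' : 'I_(m i')) : set R :=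
  if (i' == i) && (val k' == val k) then B else setT.

Lemma borel_coord_rect i k B : measurable B -> borel_rect (@coord_rect i k B).
Proof. by move=> mB i' k'; rewrite /coord_rect; case: ifP. Qed.

Lemma noise_coord_rect t i k B :
  noise_rect v t (@coord_rect i k B) = [set w | B (v t w i k ord0)].
Proof.
apply/seteqP; split=> w /=.
  by move=> /(_ i k); rewrite /coord_rect !eqxx.
move=> Bw i' k'; rewrite /coord_rect; case: ifP => // /andP[/eqP ii' /eqP kk'].
by subst i'; rewrite (val_inj kk').
Qed.

Lemma noise_ident_coord i k t (B : set R) : noise_ident P v -> measurable B ->
  P [set w | B (v t w i k ord0)] = P [set w | B (v 0 w i k ord0)].
Proof. by move=> idv mB; rewrite -!noise_coord_rect; apply: idv; exact: borel_coord_rect. Qed.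

Lemma noise_indep_coord i k s t (B C : set R) :
  noise_indep P v -> s != t -> measurable B -> measurable C ->
  P ([set w | B (v s w i k ord0)] `&` [set w | C (v t w i k ord0)]) =
  (P [set w | B (v s w i k ord0)] * P [set w | C (v t w i k ord0)])%E.
Proof.
move=> iv st mB mC.
have := iv [:: s; t] (fun r => if r == s then @coord_rect i k B else @coord_rect i k C).
rewrite !big_cons !big_nil eqxx eq_sym (negbTE st) setIT mule1 !noise_coord_rect.
by apply => [|r]; [rewrite /= inE st|case: ifP => _; exact: borel_coord_rect].
Qed.

Lemma coord_moment t i k p : 0 <= p ->
  (forall i k, measurable_fun setT (fun w => v t w i k ord0)) ->
  (\int[P]_w (stacked_norm (v t w) `^ p)%:E < +oo)%E ->
  (\int[P]_w (`|v t w i k ord0| `^ p)%:E < +oo)%E.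
Proof.
move=> p0 mv; apply: le_lt_trans; apply: ge0_le_integral => //.
- apply/measurable_EFinP; apply: (measurableT_comp (measurable_powR p)).
  exact: (measurableT_comp (@normr_measurable _ _)).
- apply/measurable_EFinP; apply: (measurableT_comp (measurable_powR p)).
  (* The square root is written as a power to use the measurability of [powR]. *)
  rewrite (_ : (fun w => _) = fun w =>
      (\sum_(i < N) \sum_(k < m i) v t w i k ord0 ^+ 2) `^ 2^-1); last first.
    apply/funext => w; rewrite powR12_sqrt// sumr_ge0// => j _.
    by rewrite sumr_ge0// => l _; exact: sqr_ge0.
  apply: (measurableT_comp (measurable_powR 2^-1)).
  by apply: measurable_sum => j; apply: measurable_sum => l; exact: measurable_funX.
- move=> w _; rewrite lee_fin; apply: ge0_ler_powR => //; rewrite ?nnegrE ?sqrtr_ge0//.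
  rewrite -sqrtr_sqr ler_wsqrtr// (bigD1 i)//= (bigD1 k)//= -addrA lerDl addr_ge0//.
    by rewrite sumr_ge0// => l _; exact: sqr_ge0.
  by rewrite sumr_ge0// => j _; rewrite sumr_ge0// => l _; exact: sqr_ge0.
Qed.

End NoiseCoordinates.

(** * Almost sure consistency of the estimator *)

Unset Implicit Arguments.
Theorem theorem3 (R : realType) (d : measure_display) (T : measurableType d)
  (P : probability T R)
  (N n : nat) (m : 'I_N -> nat) (H : forall i : 'I_N, 'M[R]_(m i, n))
  (theta : 'cV[R]_n)
  (v : nat -> T -> forall i : 'I_N, 'cV[R]_(m i))
  (A : rel 'I_N) (rho : 'I_N -> R) (x0 : 'I_N -> 'cV[R]_n)
  (a b tau1 tau2 eps1 : R) :
  (* noise: measurable, zero mean, i.i.d. over time *)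
  (forall t (i : 'I_N) (k : 'I_(m i)),
      measurable_fun setT (fun w => v t w i k ord0)) ->
  (forall t (i : 'I_N) (k : 'I_(m i)),
      (\int[P]_w (v t w i k ord0)%:E = 0)%E) ->
  noise_iid P v ->
  (* undirected graph without self-loops *)
  (forall i j, A i j = A j i) -> (forall i, ~~ A i i) ->
  (forall i, 0 < rho i) ->
  (* (i) connected graph *)
  (forall i j, connect A i j) ->
  (* (ii) G = sum_i H_i^T H_i full rank *)
  \rank (\sum_(i < N) (H i)^T *m H i)%R = n ->
  (* (iii) finite (2+eps1)-moment *)
  0 < eps1 ->
  (forall t, (\int[P]_w ((stacked_norm (v t w)) `^ (2 + eps1))%:E < +oo)%E) ->
  (* (iv) step sizes *)
  0 < a -> 0 < b -> 0 < tau2 -> tau2 <= tau1 -> tau1 <= 1 ->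
  tau2 + 1 / (2 + eps1) < tau1 -> 1 / 2 < tau1 ->
  (* rho_0 = min_j rho_j > tau1 - tau2 *)
  (forall j, tau1 - tau2 < rho j) ->
  forall i : 'I_N,
    {ae P, forall w,
      (fun t => estimate H theta A rho (step a tau1) (step b tau2) x0 (v^~ w) t i)
        @ \oo --> theta}.
Proof.
move=> mv v0 [v_indep v_ident] Asym _ _ Aconn rankG eps0 v_moment a0 b0 tau20 _ tau11
  tau_gap tau_half rho_gt i.
have p2 : 2 < 2 + eps1 by rewrite ltrDl.
have p0 : 0 < 2 + eps1 by exact: lt_trans p2.
have tau21 : tau2 < tau1.
  by apply: lt_trans tau_gap; rewrite ltrDl divr_gt0.
have tau_p : 1 / (2 + eps1) < tau1 - tau2 by rewrite ltrBrDl.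
pose X j k t : {mfun T >-> R} := HB.pack (fun w => v t w j k ord0)
  (isMeasurableFun.Build _ _ _ _ _ (mv t j k)).
have XE j k t w : X j k t w = v t w j k ord0 by [].
have X_moment j k : (\int[P]_w (`|X j k 0%N w| `^ (2 + eps1))%:E < +oo)%E.
  by apply: coord_moment (v_moment 0%N) => //; exact: ltW.
have X_ident j k t (B : set R) : measurable B -> P (X j k t @^-1` B) = P (X j k 0%N @^-1` B).
  exact: noise_ident_coord.
have X_indep j k s t (B C : set R) : s != t -> measurable B -> measurable C ->
    P ((X j k s @^-1` B) `&` (X j k t @^-1` C)) = (P (X j k s @^-1` B) * P (X j k t @^-1` C))%E.
  exact: noise_indep_coord.
(* There are finitely many agents and coordinates, so the almost sure statements can be
   intersected. *)
have series_cvg : {ae P, forall w, forall j k,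
    cvgn (series (fun t => step a tau1 t * v t w j k ord0))}.
  apply: filter_forall => j; apply: filter_forall => k.
  exact: (ae_cvg_series_step (X_ident j k) (X_indep j k) (fun t => v0 t j k) p2 (X_moment j k) a tau_half).
have small_cvg : {ae P, forall w, forall j k,
    (fun t : nat => t.+1%:R `^ (- (tau1 - tau2)) * v t w j k ord0) @ \oo --> (0 : R)}.
  apply: filter_forall => j; apply: filter_forall => k.
  exact: (ae_cvg_powRN_noise (X_ident j k) p2 (X_moment j k) tau_p).
apply: filterS2 series_cvg small_cvg => w ws wc.
exact: estimate_cvg.
Qed.
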